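(* Every finite subgroup $H<\mathcal G$ leaves some simplex of $X(\mathcal G)$ invariant (and fixes its barycenter). In particular, there are only finitely many conjugacy classes of finite subgroups in $\mathcal G$.
   Context: Let $\mathcal A$ be an Artin group of finite type with generating set $S$ and associated finite Coxeter group $\mathcal W$; $\mathcal A^+$ is the submonoid generated by $S$, and $x<y$ means $y=xz$ with $z\in\mathcal A^+$. An atom is an element of $\mathcal A^+$ whose $S$-word length equals the length of its image in $\mathcal W$; $\Delta$ is the atom mapping to the longest element of $\mathcal W$ ($\Delta^2$ central). For $g\in\mathcal A^+$, $\alpha(g)$ is the largest (for $<$) atom with $\alpha(g)<g$; the normal form of $g$ is $g=A_1\cdot\ldots\cdot A_k$ with nontrivial atoms and $A_i=\alpha(A_i\cdots A_k)$. Let $\mathcal G=\mathcal A/\langle\Delta^2\rangle$ act on $V=\mathcal A/\langle\Delta\rangle$ by left multiplication, $*=\langle\Delta\rangle$. Each $v\in V$ has a unique special representative in $\mathcal A^+$ whose normal form contains no $\Delta$; $|v|$ is its number of atoms and $d_{at}(v,w)=|g^{-1}w|$ for $g( * )=v$. $X(\mathcal G)$ is the simplicial complex on $V$ whose simplices are finite vertex sets pairwise at $d_{at}=1$; $\mathcal G$ acts on it simplicially. *)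

(* Defs.v *)
(* Artin groups encoded by words
   modulo the congruence generated by the defining relations. *)
From Stdlib Require Import Relations.
From mathcomp Require Import all_boot.
Unset Printing Implicit Defensive.

Section Artin.
Context {I : finType}.
Variable m : I -> I -> nat.

(* Words in S ∪ S^{-1}: (s, true) = s, (s, false) = s^{-1}. *)
Definition word := seq (I * bool).

Definition pw (p : seq I) : word := map (fun i => (i, true)) p.

Definition winv (w : word) : word := rev (map (fun x => (x.1, ~~ x.2)) w).

Definition alt (a b : I) (n : nat) : seq I := mkseq (fun k => if odd k then b else a) n.

Inductive ctx (T : Type) (R : seq T -> seq T -> Prop) : seq T -> seq T -> Prop :=
  ctx_intro (u v l r : seq T) : R l r -> ctx T R (u ++ l ++ v) (u ++ r ++ v).

Inductive artin_rel : word -> word -> Prop :=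
| ar_free i b : artin_rel [:: (i, b); (i, ~~ b)] [::]
| ar_braid i j : artin_rel (pw (alt i j (m i j))) (pw (alt j i (m i j))).

Definition aeq : word -> word -> Prop := clos_refl_sym_trans _ (ctx _ artin_rel).

Inductive cox_rel : seq I -> seq I -> Prop :=
| cr_sq i : cox_rel [:: i; i] [::]
| cr_braid i j : cox_rel (alt i j (m i j)) (alt j i (m i j)).

Definition weq : seq I -> seq I -> Prop := clos_refl_sym_trans _ (ctx _ cox_rel).

Definition coxlen (w : seq I) (n : nat) : Prop :=
  (exists u, weq w u /\ size u = n) /\ (forall u, weq w u -> n <= size u).

Definition coxeter_finite : Prop :=
  exists L : seq (seq I), forall w, exists2 u, u \in L & weq w u.

Definition pos (g : word) : Prop := exists p, aeq g (pw p).

Definition prec (x y : word) : Prop := exists z, pos z /\ aeq y (x ++ z).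

Definition is_atom (g : word) : Prop :=
  exists p : seq I, aeq g (pw p) /\ coxlen p (size p).

Definition is_Delta (d : word) : Prop :=
  exists p : seq I, aeq d (pw p) /\ coxlen p (size p) /\
    (forall w n, coxlen w n -> n <= size p).

Definition is_alpha (a g : word) : Prop :=
  is_atom a /\ prec a g /\ (forall b, is_atom b -> prec b g -> prec b a).

Definition normal_form (g : word) (As : seq word) : Prop :=
  aeq g (flatten As) /\
  (forall a, a \in As -> ~ aeq a [::]) /\
  (forall i, i < size As -> is_alpha (nth [::] As i) (flatten (drop i As))).

Variable d : word.

Definition dpow (b : bool) (n : nat) : word :=
  flatten (nseq n (if b then d else winv d)).

(* equality in V = A/<Delta> (left cosets g<Delta>) *)
Definition veq (u v : word) : Prop := exists b n, aeq u (v ++ dpow b n).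

(* equality in G = A/<Delta^2> *)
Definition geq (u v : word) : Prop := exists b n, aeq u (v ++ dpow b n.*2).

(* |v| = k : the special representative p of v (p in A^+, p<Delta> = v,
   normal form of p contains no Delta) has k atoms in its normal form *)
Definition vlen (v : word) (k : nat) : Prop :=
  exists p As, veq v p /\ normal_form p As /\
    (forall a, a \in As -> ~ aeq a d) /\ size As = k.

(* d_at(v, w) = |g^{-1} w| with g(star) = v  (we take g = v itself) *)
Definition dat (v w : word) (k : nat) : Prop := vlen (winv v ++ w) k.

Definition is_simplex (s : seq word) : Prop :=
  s != [::] /\
  (forall u v, u \in s -> v \in s -> ~ veq u v -> dat u v 1).

Definition is_subgroupG (H : word -> Prop) : Prop :=
  H [::] /\ (forall x y, H x -> H y -> H (x ++ y)) /\
  (forall x, H x -> H (winv x)) /\ (forall x y, geq x y -> H y -> H x).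

Definition finiteG (H : word -> Prop) : Prop :=
  exists L : seq word, forall h, H h -> exists2 l, l \in L & geq h l.

Definition leaves_invariant (H : word -> Prop) (s : seq word) : Prop :=
  forall h, H h ->
    (forall v, v \in s -> exists2 v', v' \in s & veq (h ++ v) v') /\
    (forall v', v' \in s -> exists2 v, v \in s & veq (h ++ v) v').

Definition conjG (H K : word -> Prop) : Prop :=
  exists g, forall x, H x <-> K (winv g ++ x ++ g).

End Artin.

(* Main.v *)
Require Import Defs.
From Stdlib Require Import Relations.
From Stdlib Require Import ClassicalEpsilon FunctionalExtensionality PropExtensionality.
From HB Require Import structures.
From mathcomp Require Import all_boot all_order all_algebra all_field zify ring.

(* The positive monoid A+ is cancellative, has least common multiples and
   embeds in A, so A ordered by [x <= y iff x^-1 y in A+] has binary joins. The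
   order is invariant under left multiplications and under the right
   multiplication by Delta. Let H~ be the preimage in A of a finite subgroup H
   of G. As H~ is finite modulo the central Delta^2, the elements h Delta^j of
   nonpositive degree, with h in H~ and j in Z, have a join x, and
   h x Delta^j <= x whenever h Delta^j has nonpositive degree. Hence the points
   h x Delta^j form a chain: whenever deg(h) is between j deg(Delta) and
   (j+1) deg(Delta), h x lies between x Delta^j and x Delta^(j+1). So h x is
   x a Delta^j for an atom a, and the vertices h x span an H-invariant simplex.
   Translating x to the identity, H is conjugate to a subgroup contained in the
   finite set of classes of the a and a Delta, a an atom.

   The Garside structure of A+ comes from the weak order of W, a lattice whose
   joins are found by descending induction. The largest atom dividing an
   element, and the corresponding quotient, are computed letter by letter on
   words by an action of A+ on W * A+; this yields cancellation and lcms. *)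

Set Implicit Arguments.
Unset Strict Implicit.

(** * Monoids presented by generators and relations *)
Section Presentation.
Variables (T : choiceType) (R : seq T -> seq T -> Prop).

Definition cong : seq T -> seq T -> Prop := clos_refl_sym_trans _ (ctx T R).

Lemma cong_refl u : cong u u. Proof. exact: rst_refl. Qed.

Lemma cong_sym u v : cong u v -> cong v u. Proof. exact: rst_sym. Qed.

Lemma cong_trans v u w : cong u v -> cong v w -> cong u w.
Proof. exact: rst_trans. Qed.

Lemma cong_rel l r : R l r -> cong l r.
Proof.
move=> Rlr; apply: rst_step.
by have := ctx_intro T R [::] [::] l r Rlr; rewrite !cats0.
Qed.

(** [E] may be any equivalence, not only equality: it is also used with [cong] itself and with
    [fraction_eq], whose transitivity needs cancellation. *)
Lemma cong_invariant (X : Type) (E : X -> X -> Prop) (f : seq T -> X) :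
  (forall x, E x x) -> (forall x y, E x y -> E y x) ->
  (forall x y z, E x y -> E y z -> E x z) ->
  (forall u v l r, R l r -> E (f (u ++ l ++ v)) (f (u ++ r ++ v))) ->
  forall p q, cong p q -> E (f p) (f q).
Proof.
move=> Er Es Et fR p q; elim=> {p q}[_ _ [u v l r /fR//]|p|p q _|p q r _ + _] //.
- exact: Es.
- exact: Et.
Qed.

Lemma cong_cat u u' v v' : cong u u' -> cong v v' -> cong (u ++ v) (u' ++ v').
Proof.
move=> uu' vv'; apply: (@cong_trans (u' ++ v)).
  apply: (@cong_invariant _ cong (cat^~ v)) uu' => *.
  - exact: cong_refl.
  - exact: cong_sym.
  - by eapply cong_trans; eassumption.
  - by rewrite -!catA; apply: rst_step; apply: ctx_intro.
apply: (@cong_invariant _ cong (cat u')) vv' => *.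
- exact: cong_refl.
- exact: cong_sym.
- by eapply cong_trans; eassumption.
- by rewrite !(catA u'); apply: rst_step; apply: ctx_intro.
Qed.

(** Congruent words choose the same representative, so the quotient becomes a subtype with Leibniz
    equality. *)
Definition canon (w : seq T) : seq T := epsilon (inhabits [::]) (cong w).

Lemma canonP w : cong w (canon w).
Proof. by apply: epsilon_spec; exists w; apply: cong_refl. Qed.

Lemma canon_eq u v : cong u v -> canon u = canon v.
Proof.
move=> uv; congr epsilon; apply: functional_extensionality => w.
by apply: propositional_extensionality; split; apply: cong_trans => //; apply: cong_sym.
Qed.

Lemma canonK w : canon (canon w) == canon w.
Proof. by apply/eqP/canon_eq/cong_sym/canonP. Qed.

Record presented := Presented { word_of : seq T; _ : canon word_of == word_of }.

HB.instance Definition _ := [isSub for word_of].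
HB.instance Definition _ := [Choice of presented by <:].

Definition cls (w : seq T) : presented := Presented (canonK w).

Lemma clsP u v : cls u = cls v <-> cong u v.
Proof.
split=> [[uv]|uv]; last by apply: val_inj; apply: canon_eq.
by apply: cong_trans (canonP u) _; rewrite uv; apply/cong_sym/canonP.
Qed.

Lemma word_ofK x : cls (word_of x) = x.
Proof. by case: x => w w_canon; apply: val_inj; apply: eqP. Qed.

Fact presented_key : unit. Proof. by []. Qed.
Definition presented_mul (x y : presented) :=
  locked_with presented_key (cls (word_of x ++ word_of y)).

Lemma cls_cat_subproof u v : presented_mul (cls u) (cls v) = cls (u ++ v).
Proof.
by rewrite /presented_mul unlock; apply/clsP/cong_cat; apply/cong_sym/canonP.
Qed.

Lemma presented_mulA : associative presented_mul.
Proof.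
by move=> x y z; rewrite -[x]word_ofK -[y]word_ofK -[z]word_ofK !cls_cat_subproof catA.
Qed.

Lemma presented_mul1 : left_id (cls [::]) presented_mul.
Proof. by move=> x; rewrite -[x]word_ofK cls_cat_subproof. Qed.

Lemma presented_mulr1 : right_id (cls [::]) presented_mul.
Proof. by move=> x; rewrite -[x]word_ofK cls_cat_subproof cats0. Qed.

HB.instance Definition _ :=
  isMonoid.Build presented presented_mulA presented_mul1 presented_mulr1.

Lemma cls_cat u v : cls (u ++ v) = (cls u * cls v)%g.
Proof. by rewrite -cls_cat_subproof. Qed.

End Presentation.

(** * The Coxeter group *)

Section Coxeter.
Local Open Scope group_scope.
Variables (I : finType) (m : I -> I -> nat).

Definition coxeter := presented (cox_rel m).
HB.instance Definition _ := Monoid.on coxeter.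

Definition ew (p : seq I) : coxeter := cls (cox_rel m) p.

Lemma ewP p q : ew p = ew q <-> weq m p q. Proof. exact: clsP. Qed.

Lemma ew_surj w : exists p, ew p = w.
Proof. by exists (word_of w); apply: word_ofK. Qed.

Lemma ew_cat p q : ew (p ++ q) = ew p * ew q. Proof. exact: cls_cat. Qed.

Lemma ew_nil : ew [::] = 1. Proof. by []. Qed.

Definition gw (i : I) : coxeter := ew [:: i].

Lemma ew_cons i p : ew (i :: p) = gw i * ew p. Proof. exact: (ew_cat [:: i]). Qed.

Lemma ew_rcons p i : ew (rcons p i) = ew p * gw i.
Proof. by rewrite -cats1 ew_cat. Qed.

Lemma gw_sq i : gw i * gw i = 1.
Proof. by rewrite -ew_cat; apply/clsP/cong_rel; constructor. Qed.

Lemma ew_revV p : ew (rev p) * ew p = 1.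
Proof.
elim: p => [|i p IH]; first by rewrite mulg1.
by rewrite rev_cons ew_rcons ew_cons mulgA -(mulgA (ew _)) gw_sq mulg1.
Qed.

Definition coxeter_inv (w : coxeter) :=
  locked_with presented_key (ew (rev (word_of w))).

Lemma coxeter_mulVg : left_inverse 1 coxeter_inv *%g.
Proof. by move=> w; rewrite /coxeter_inv unlock -{2}(word_ofK w) ew_revV. Qed.

Lemma coxeter_mulgV : right_inverse 1 coxeter_inv *%g.
Proof.
by move=> w; rewrite /coxeter_inv unlock -{1}(word_ofK w) -{1}(revK (word_of w)) ew_revV.
Qed.

HB.instance Definition _ := hasInv.Build coxeter coxeter_inv.
HB.instance Definition _ :=
  Monoid_isGroup.Build coxeter coxeter_mulVg coxeter_mulgV.

Lemma ew_rev p : ew (rev p) = (ew p)^-1.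
Proof. by apply: (mulIg (ew p)); rewrite ew_revV mulVg. Qed.

Lemma gwV i : (gw i)^-1 = gw i.
Proof. by rewrite -ew_rev. Qed.

Lemma gwK i : involutive ( *%g (gw i)).
Proof. by move=> w; rewrite mulgA gw_sq mul1g. Qed.

Lemma ew_braid i j : ew (alt i j (m i j)) = ew (alt j i (m i j)).
Proof. by apply/clsP/cong_rel; constructor. Qed.

Lemma ew_invariant X (f : seq I -> X) :
  (forall u i v, f (u ++ [:: i, i & v]) = f (u ++ v)) ->
  (forall u i j v, f (u ++ alt i j (m i j) ++ v) = f (u ++ alt j i (m i j) ++ v)) ->
  forall p q, ew p = ew q -> f p = f q.
Proof.
move=> fsq fbraid p q /ewP; apply: (cong_invariant (E := eq)) => //.
- by move=> ? ? ? -> ->.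
- by move=> u v l r [i|i j]; [rewrite fsq | rewrite fbraid].
Qed.

End Coxeter.

(** * Alternating words in two letters *)

Section Alternating.
Variable I : finType.
Implicit Types (i j : I) (n k : nat).

Lemma size_alt i j n : size (alt i j n) = n.
Proof. exact: size_mkseq. Qed.

Lemma alt_rcons i j n :
  alt i j n.+1 = rcons (alt i j n) (if odd n then j else i).
Proof. by rewrite /alt /mkseq -addn1 iotaD map_cat cats1. Qed.

Lemma alt_cons i j n : alt i j n.+1 = i :: alt j i n.
Proof.
by elim: n => [//|n IH]; rewrite alt_rcons IH alt_rcons /=; case: odd.
Qed.

Lemma alt_cat i j k n :
  alt i j (k + n) = alt i j k ++ (if odd k then alt j i n else alt i j n).
Proof.
elim: k i j => [//|k IH] i j; rewrite addSn !alt_cons /= IH.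
by case: (odd k).
Qed.

Lemma alt_rev i j n :
  rev (alt i j n) = if odd n then alt i j n else alt j i n.
Proof.
elim: n i j => [//|n IH] i j.
rewrite {1}alt_cons rev_cons IH /= !alt_rcons.
by case: (odd n).
Qed.

End Alternating.

(** * Length and exchange in Coxeter groups *)
Section Length.
Local Open Scope group_scope.
Variables (I : finType) (m : I -> I -> nat).
Local Notation W := (coxeter m).
Local Notation e := (ew m).
Local Notation s := (gw m).
Implicit Types (i j : I) (p q : seq I) (w x y z t : W).

(** Up to a braid relation the second half is the reverse of the first, and reversal inverts. *)
Lemma ew_alt_sq i j : e (alt i j (m i j + m i j)) = 1.
Proof.
have := alt_rev i j (m i j); rewrite alt_cat ew_cat.
case: ifP => _ rev_alt; first by rewrite -ew_braid -{1}rev_alt ew_revV.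
by rewrite {1}ew_braid -rev_alt ew_revV.
Qed.

Definition spells n w := [exists p : n.-tuple I, e p == w].

Lemma spells_ex w : exists n, spells n w.
Proof.
by have [p <-] := ew_surj w; exists (size p); apply/existsP; exists (in_tuple p).
Qed.

Definition len w := ex_minn (spells_ex w).

Lemma len_ew p : len (e p) <= size p.
Proof.
by rewrite /len; case: ex_minnP => n _; apply; apply/existsP; exists (in_tuple p).
Qed.

Lemma red_ex w : exists p, (e p == w) && (size p == len w).
Proof.
rewrite /len; case: ex_minnP => n /existsP[p pw] _.
by exists p; rewrite pw size_tuple eqxx.
Qed.

Definition red w : seq I := xchoose (red_ex w).

Lemma ew_red w : e (red w) = w.
Proof. by have /andP[/eqP] := xchooseP (red_ex w). Qed.

Lemma size_red w : size (red w) = len w.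
Proof. by have /andP[_ /eqP] := xchooseP (red_ex w). Qed.

Lemma coxlenP p n : coxlen m p n <-> n = len (e p).
Proof.
split=> [[[u [/ewP pu <-]] min]|->].
  apply/eqP; rewrite eqn_leq pu len_ew andbT -pu -size_red.
  by apply: min; apply/ewP; rewrite ew_red.
split; first by exists (red (e p)); rewrite size_red; split=> //; apply/ewP; rewrite ew_red.
by move=> u /ewP->; apply: len_ew.
Qed.

Lemma len1 : len 1 = 0.
Proof. by apply/eqP; rewrite -leqn0 -ew_nil; apply: len_ew. Qed.

Lemma len_eq0 w : (len w == 0) = (w == 1).
Proof.
apply/idP/eqP => [|->]; last by rewrite len1.
by rewrite -size_red -{2}[w]ew_red => /nilP->.
Qed.

Lemma len_mul x y : len (x * y) <= len x + len y.
Proof.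
by rewrite -{1}[x]ew_red -{1}[y]ew_red -ew_cat (leq_trans (len_ew _)) ?size_cat ?size_red.
Qed.

Lemma lenV w : len w^-1 = len w.
Proof.
have le x : len x^-1 <= len x.
  by rewrite -{1}[x]ew_red -ew_rev (leq_trans (len_ew _)) ?size_rev ?size_red.
by apply/eqP; rewrite eqn_leq le -{1}[w]invgK le.
Qed.

Lemma ew_odd p q : e p = e q -> odd (size p) = odd (size q).
Proof.
apply: (ew_invariant (f := odd \o size)) => [u i v|u i j v] /=.
  by rewrite !size_cat /= !oddD /= negbK.
by rewrite !size_cat !size_alt.
Qed.

Lemma len_odd p : odd (len (e p)) = odd (size p).
Proof. by rewrite -size_red; apply: ew_odd; rewrite ew_red. Qed.

Lemma len_gw_neq i w : len (s i * w) != len w.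
Proof.
apply/eqP => /(congr1 odd); rewrite -{1}[w]ew_red -ew_cons len_odd /= size_red.
by case: odd.
Qed.

Lemma len_gw i : len (s i) = 1%N.
Proof.
have := len_gw_neq i 1; have := len_ew [:: i]; rewrite mulg1 len1 /=.
by rewrite -/(s i); case: (len _) => [|[]].
Qed.

Lemma len_gwM i w :
  len (s i * w) = if len (s i * w) < len w then (len w).-1 else (len w).+1.
Proof.
have := len_gw_neq i w; have := len_mul (s i) w; have := len_mul (s i) (s i * w).
by rewrite gwK len_gw; case: ifP; lia.
Qed.

(* Each letter [i] of [p = p1 ++ i :: p2] contributes the reflection
   [e p1 * s i * (e p1)^-1]; [crosses p t] is the parity of the occurrences of
   [t]. It depends only on [e p], whence the exchange condition. *)
Fixpoint crosses p t : bool :=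
  if p is i :: q then (t == s i) (+) crosses q (s i * t * s i) else false.

Lemma crosses_cat p q t :
  crosses (p ++ q) t = crosses p t (+) crosses q ((e p)^-1 * t * e p).
Proof.
elim: p t => [|i p IH] t /=; first by rewrite invg1 mul1g mulg1.
by rewrite IH addbA ew_cons invgM gwV !mulgA.
Qed.

Lemma gw_conj_eq i t x : (s i * t * s i == x) = (t == s i * x * s i).
Proof.
by apply/eqP/eqP=> [<-|->]; rewrite !mulgA gw_sq mul1g -mulgA gw_sq mulg1.
Qed.

Lemma crosses_alt i j n t :
  crosses (alt i j n) t = \big[addb/false]_(k < n) (t == e (alt i j k.*2.+1)).
Proof.
elim: n i j t => [|n IH] i j t; first by rewrite big_ord0.
rewrite alt_cons /= IH big_ord_recl; congr (_ (+) _).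
apply: eq_bigr => k _; rewrite gw_conj_eq; congr (t == _).
rewrite /= /bump /= add1n doubleS [in RHS]alt_cons [in RHS]alt_rcons.
by rewrite ew_cons ew_rcons /= odd_double mulgA.
Qed.

(** Placed end to end, the two words form the alternating word of size [m i j + m i j], which spells
    [1]; a palindrome is its own inverse. *)
Lemma ew_alt_flip i j k : k < m i j ->
  e (alt j i k.*2.+1) = e (alt i j (m i j - k.+1).*2.+1).
Proof.
move=> k_lt; set n := (_ - _).*2.+1.
apply: (mulgI (e (alt i j n))).
have n_odd: odd n by rewrite /= odd_double.
have := ew_alt_sq i j; have ->: m i j + m i j = n + k.*2.+1 by rewrite /n; lia.
rewrite alt_cat n_odd ew_cat => ->.
have alt_palindrome : rev (alt i j n) = alt i j n by rewrite alt_rev n_odd.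
by rewrite -{1}alt_palindrome ew_revV.
Qed.

(** A square crosses the same reflection twice; by [ew_alt_flip] the two sides of a braid relation
    cross the same reflections in opposite orders. *)
Lemma crosses_ew p q : e p = e q -> crosses p =1 crosses q.
Proof.
move=> pq t; move: t p q pq => t; apply: ew_invariant => [u i v|u i j v].
  rewrite !crosses_cat /=; congr (_ (+) _); move: ((e u)^-1 * t * e u) => x.
  rewrite gw_conj_eq gw_sq mul1g addbA addbb addFb.
  by rewrite !mulgA gw_sq mul1g -mulgA gw_sq mulg1.
rewrite !crosses_cat ew_braid; congr (_ (+) (_ (+) _)).
rewrite !crosses_alt (reindex_inj rev_ord_inj) /=.
by apply: eq_bigr => k _; rewrite (ew_alt_flip (ltn_ord k)).
Qed.

Lemma crosses_split p t : crosses p t ->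
  exists p1 j p2, p = p1 ++ j :: p2 /\ t * e p1 = e p1 * s j.
Proof.
elim: p t => [//|i p IH] t /=; case: eqP => [-> _|_ /IH].
  by exists [::], i, p; rewrite mulg1 mul1g.
case=> p1 [j [p2 [-> tp1]]]; exists (i :: p1), j, p2; split=> //.
by rewrite ew_cons -!mulgA -tp1 !mulgA gw_sq mul1g.
Qed.

(** This is the strong exchange condition: [t] moves past [p1] as [s j] and cancels the letter
    [j]. *)
Lemma crosses_del p t : crosses p t ->
  exists p1 j p2, p = p1 ++ j :: p2 /\ t * e p = e (p1 ++ p2).
Proof.
case/crosses_split=> p1 [j [p2 [-> tp1]]]; exists p1, j, p2; split=> //.
by rewrite !ew_cat ew_cons mulgA tp1 -mulgA gwK.
Qed.

Definition descent i w := len (s i * w) < len w.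

(** If [p] crosses [s i], exchange shortens a reduced word. Otherwise [i :: p] crosses [s i], so
    [s i] shortens [s i * e p] and [i] is no descent. *)
Lemma descent_crosses i p : descent i (e p) = crosses p (s i).
Proof.
have lt_cross q : crosses q (s i) -> descent i (e q).
  rewrite -(crosses_ew (ew_red (e q))) => /crosses_del[p1 [j [p2 [def_p del]]]].
  have := len_ew (p1 ++ p2); rewrite -del ew_red /descent => /leq_ltn_trans; apply.
  by rewrite -(size_red (e q)) def_p !size_cat addnS.
apply/idP/idP => [|/lt_cross//]; apply: contraTT => ncr.
have: crosses (i :: p) (s i) by rewrite /= eqxx gw_sq mul1g.
by move/lt_cross; rewrite /descent ew_cons gwK -leqNgt => /ltnW.
Qed.

End Length.

(** * Orders of products of two generators *)
Section NumbersGame.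
Import GRing.Theory Num.Theory.
Local Open Scope ring_scope.

(** [n.-1.+1] is [n] for positive [n], and is positive in every case, so that the root always
    exists. *)
Fact zeta_ex n : {z : algC | n.-1.+1.*2.-primitive_root z}.
Proof. exact: C_prim_root_exists. Qed.

Definition zeta n : algC := sval (zeta_ex n).

Lemma zetaP n : (0 < n)%N -> n.*2.-primitive_root (zeta n).
Proof. by case: n => // n _; rewrite /zeta; case: zeta_ex. Qed.

Lemma zeta_neq0 n : (0 < n)%N -> zeta n != 0.
Proof.
move=> n_gt0; apply/eqP => z0; have := prim_expr_order (zetaP n_gt0).
by rewrite z0 expr0n double_eq0 eqn0Ngt n_gt0 => /eqP; rewrite eq_sym oner_eq0.
Qed.

Lemma zeta_sq n k : (0 < n)%N -> zeta n ^+ k.*2 = 1 -> (n %| k)%N.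
Proof.
by move=> n_gt0 /eqP; rewrite -(prim_order_dvd (zetaP n_gt0)) -!muln2 dvdn_pmul2r.
Qed.

Lemma zeta_half n : (0 < n)%N -> zeta n ^+ n = -1.
Proof.
move=> n_gt0; have /eqP := prim_expr_order (zetaP n_gt0).
rewrite -muln2 exprM sqrf_eq1 => /orP[|/eqP//] /eqP zn1.
have /eqP := zn1; rewrite -(prim_order_dvd (zetaP n_gt0)) => /dvdn_leq.
by move=> /(_ n_gt0); rewrite -addnn; lia.
Qed.

Variables (I : finType) (m : I -> I -> nat).
Hypothesis m_diag : forall i, m i i = 1%N.
Hypothesis m_sym : forall i j, m i j = m j i.
Hypothesis m_ge2 : forall i j, i != j -> (2 <= m i j)%N.

(** Each entry is [2 cos (k * pi / m i l)] for some [k] prime to [2 * m i l]. Any primitive root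
    will do, since only identities between roots of unity are used. *)
Definition cartan i l := zeta (m i l) + (zeta (m i l))^-1.

Lemma cartanii i : cartan i i = - 2%:R.
Proof.
have := @zeta_half 1 isT; rewrite expr1 /cartan m_diag => ->.
by rewrite invrN1 -opprD.
Qed.

(* The contragredient of the geometric representation. *)
Definition fire (x : {ffun I -> algC}) i := [ffun l => x l + cartan i l * x i].

Lemma fireK i x : fire (fire x i) i = x.
Proof.
by apply/ffunP => l; rewrite !ffunE cartanii; ring.
Qed.

Definition game p x := foldl fire x p.

Lemma game_cat p q x : game (p ++ q) x = game q (game p x).
Proof. exact: foldl_cat. Qed.

Section Pair.
Variables i j : I.
Hypothesis ij : i != j.
Let n := m i j.
Let z := zeta n.
Let w := z^-1.

Lemma zw : z * w = 1.
Proof.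
by rewrite mulfV // zeta_neq0 // (leq_trans _ (m_ge2 ij)).
Qed.

Lemma zn : z ^+ n = -1.
Proof. by rewrite zeta_half // (leq_trans _ (m_ge2 ij)). Qed.

Lemma wn : w ^+ n = -1.
Proof. by rewrite exprVn zn invrN1. Qed.

Lemma z_sq_neq1 : z ^+ 2 != 1.
Proof.
have n_ge2 := m_ge2 ij; apply/eqP => z1.
have := @zeta_sq n 1 (leq_trans _ n_ge2) z1; rewrite dvdn1 => /(_ isT) /eqP n1.
by rewrite /n in n1; rewrite n1 in n_ge2.
Qed.
End Pair.

(* [A z^k + B w^k] is the value fired at step [k] of an alternating play. *)
Lemma game_alt i j (x : {ffun I -> algC}) (z := zeta (m i j)) (w := z^-1) A B :
  i != j -> A + B = - x j -> A * z + B * w = x i ->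
  forall k (y := game (alt i j k) x),
  [/\ y (if odd k then j else i) = A * z ^+ k.+1 + B * w ^+ k.+1,
      y (if odd k then i else j) = - (A * z ^+ k + B * w ^+ k)
    & forall l, y l = x l + \sum_(t < k) cartan (if odd t then j else i) l
                              * (A * z ^+ t.+1 + B * w ^+ t.+1)].
Proof.
move=> ij AB ABz; have zw1 : z * w = 1 by apply: zw.
elim=> [|k [IH1 IH2 IH3]].
  by split=> [||l]; rewrite ?big_ord0 ?addr0 //= ?expr1 ?expr0 ?mulr1 ?AB ?opprK.
move=> y; rewrite /y alt_rcons -cats1 game_cat /= !(if_neg, ffunE) cartanii IH1.
have cE : cartan (if odd k then j else i) (if odd k then i else j) = z + w.
  by rewrite /cartan; case: odd; rewrite // m_sym.
split=> [||l].
- rewrite cE IH2 !exprS; ring: zw1.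
- by ring.
- by rewrite ffunE IH1 IH3 big_ord_recr addrA.
Qed.

(** The second play fires the values of the first in reverse order: at the same vertices if [m i j]
    is even, at the opposite ones if it is odd, and then the difference is a vanishing geometric
    sum. *)
Lemma game_braid i j x : game (alt i j (m i j)) x = game (alt j i (m i j)) x.
Proof.
have [->//|ij] := eqVneq i j.
set n := m i j; set z := zeta n; set w := z^-1.
have zw1 : z * w = 1 := zw ij; have zn1 : z ^+ n = -1 := zn ij.
have wn1 : w ^+ n = -1 := wn ij; have z21 : z ^+ 2 != 1 := z_sq_neq1 ij.
have zmw : z - w != 0.
  apply: contra z21 => /eqP zmw; apply/eqP; rewrite expr2 -zw1; congr (_ * _).
  by apply/eqP; rewrite -subr_eq0 zmw.
(* [A] and [B] solve the two equations below, a system of determinant [w - z]. *)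
pose A := (x i + x j * w) / (z - w); pose B := - x j - A.
have AB : A + B = - x j by rewrite /B; ring.
have ABz : A * z + B * w = x i.
  have: A * (z - w) = x i + x j * w by rewrite /A mulfVK.
  by rewrite /B => eA; transitivity (A * (z - w) - x j * w); [ring | rewrite eA; ring].
have [_ _ sum_ij] := game_alt ij AB ABz n.
have ji : j != i by rewrite eq_sym.
have AB' : - (B * w) + - (A * z) = - x i by rewrite -ABz; ring.
have ABz' : - (B * w) * zeta (m j i) + - (A * z) / zeta (m j i) = x j.
  rewrite (m_sym j i) -/n -/z -/w; apply: oppr_inj; rewrite -AB; ring: zw1.
have [_ _ sum_ji] := game_alt ji AB' ABz' n.
apply/ffunP => l; rewrite sum_ij sum_ji; congr (_ + _).
rewrite [RHS](reindex_inj rev_ord_inj) /= (m_sym j i) -/n -/z -/w.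
have rew (t : 'I_n) : - (B * w) * z ^+ (n - t.+1).+1 + - (A * z) * w ^+ (n - t.+1).+1
    = A * z ^+ t.+1 + B * w ^+ t.+1.
  have zwX k : z ^+ k * w ^+ k = 1 by rewrite -exprMn zw1 expr1n.
  have zX : z ^+ (n - t.+1).+1 = - w ^+ t.
    apply: (mulIf (expf_neq0 t (_ : z != 0))).
      by apply: contra_neq (oner_neq0 algC) => z0; rewrite -zw1 z0 mul0r.
    rewrite -exprD mulNr [w ^+ t * _]mulrC zwX -zn1; congr (z ^+ _).
    by have := ltn_ord t; lia.
  have wX : w ^+ (n - t.+1).+1 = - z ^+ t.
    apply: (mulIf (expf_neq0 t (_ : w != 0))).
      by apply: contra_neq (oner_neq0 algC) => w0; rewrite -zw1 w0 mulr0.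
    rewrite -exprD mulNr zwX -wn1; congr (w ^+ _).
    by have := ltn_ord t; lia.
  by rewrite zX wX !exprS; ring.
under [RHS]eq_bigr => t _ do rewrite rew.
case n_odd: (odd n); last first.
  apply: eq_bigr => t _; rewrite oddB ?ltn_ord //= n_odd /= if_neg.
  by case: odd.
apply/eqP; rewrite -subr_eq0 -sumrB.
have altE (t : 'I_n) : true ->
   cartan (if odd t then j else i) l * (A * z ^+ t.+1 + B * w ^+ t.+1) -
   cartan (if odd (n - t.+1) then i else j) l * (A * z ^+ t.+1 + B * w ^+ t.+1)
   = (cartan i l - cartan j l) * (A * z * (- z) ^+ t + B * w * (- w) ^+ t).
  move=> _; rewrite oddB ?ltn_ord //= n_odd /= negbK (exprNn z t) (exprNn w t).
  rewrite -signr_odd !exprS.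
  by case: odd; rewrite /= ?expr1 ?expr0; ring.
rewrite (eq_bigr _ altE) -mulr_sumr big_split /= -!mulr_sumr.
(* As [n] is odd, [- a] is an [n]-th root of unity other than [1], so its powers add up to [0]. *)
have geom (a : algC) : a ^+ n = -1 -> 1 + a != 0 -> \sum_(t < n) (- a) ^+ t = 0.
  move=> an a1; apply: (mulfI a1); rewrite mulr0.
  have := subrX1 (- a) n; rewrite exprNn an -signr_odd n_odd expr1 mulrNN mulr1 subrr.
  move/esym/eqP; rewrite mulf_eq0 => /orP[|/eqP->]; last by rewrite mulr0.
  by rewrite -opprD oppr_eq0 addrC (negbTE a1).
have z1 : 1 + z != 0.
  apply: contra z21; rewrite addrC addr_eq0 => /eqP->; by rewrite sqrrN expr1n.
have w1 : 1 + w != 0.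
  apply: contra z1 => /eqP w1; apply/eqP.
  by transitivity (z * (1 + w)); [rewrite mulrDr zw1; ring | rewrite w1 mulr0].
by rewrite !geom // !mulr0 addr0 mulr0.
Qed.

Lemma game_ew p q x : ew m p = ew m q -> game p x = game q x.
Proof.
apply: (ew_invariant (f := game^~ x)) => [u i v|u i j v].
  by rewrite !game_cat /= fireK.
by rewrite !game_cat game_braid.
Qed.

(** With [ew_alt_sq], this says that [s i * s j] has order exactly [m i j]. *)
Lemma ew_alt_neq i j k : (0 < k < m i j)%N ->
  ew m (alt i j k) <> ew m (alt j i k).
Proof.
case/andP=> k_gt0 k_lt eq_alt.
have ij : i != j by apply: contraL k_lt => /eqP->; rewrite m_diag ltnS -ltnNge.
have n_gt0 : (0 < m i j)%N by apply: ltn_trans k_lt.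
have ji : j != i by rewrite eq_sym.
set z := zeta (m i j); have zw1 : z * z^-1 = 1 := zw ij.
(* From this start both plays are purely geometric. They leave [- z ^+ k] and [- z ^- k] at the same
   vertex, so equal outcomes give [z ^+ k.*2 = 1]. *)
pose x := [ffun l => if l == i then z else -1].
have [||_ v _] := @game_alt i j x 1 0 ij _ _ k.
- by rewrite addr0 !ffunE (negbTE ji) opprK.
- by rewrite mul1r mul0r addr0 !ffunE eqxx.
have [||u _ _] := @game_alt j i x 0 (- z) ji _ _ k.
- by rewrite add0r !ffunE eqxx.
- by rewrite !ffunE (negbTE ji) mul0r add0r m_sym mulNr zw1.
move: u v; rewrite (game_ew x eq_alt) m_sym -/z => -> /eqP.
rewrite mul0r !mul1r !add0r mul0r addr0 mulNr eqr_opp exprS mulrA zw1 mul1r => /eqP zk.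
have : (m i j %| k)%N.
  apply: zeta_sq => //; rewrite -addnn exprD -/z -{1}zk -exprMn mulrC.
  by rewrite zw1 expr1n.
by move=> /(dvdn_leq k_gt0); rewrite leqNgt k_lt.
Qed.

End NumbersGame.

(** * The weak order *)
Section WeakOrder.
Local Open Scope group_scope.
Variables (I : finType) (m : I -> I -> nat).
Local Notation W := (coxeter m).
Local Notation e := (ew m).
Local Notation s := (gw m).
Implicit Types (i j : I) (p q : seq I) (w x y z g : W).

(* Distinct canonical structures on [W] yield convertible, but syntactically
   different products, which [lia] would treat as different atoms. *)
Let wmul : W -> W -> W := *%g.
Let winvg : W -> W := fun x => x^-1.
Ltac len_lia :=
  repeat match goal with
  | H : context [@monoid.mul ?S] |- _ => change (@monoid.mul S) with wmul in H
  | |- context [@monoid.mul ?S] => change (@monoid.mul S) with wmul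
  | H : context [@monoid.inv ?S] |- _ => change (@monoid.inv S) with winvg in H
  | |- context [@monoid.inv ?S] => change (@monoid.inv S) with winvg
  end; lia.

(** The prefix order, or right weak order. *)
Definition wle x y := len y == len x + len (x^-1 * y).

Lemma wleE x y : wle x (x * y) = (len (x * y) == len x + len y).
Proof. by rewrite /wle mulKg. Qed.

Lemma wle_refl x : wle x x. Proof. by rewrite /wle mulVg len1 addn0. Qed.

Lemma wle1 x : wle 1 x. Proof. by rewrite /wle len1 invg1 mul1g. Qed.

Lemma wle_len x y : wle x y -> len x <= len y.
Proof. by move/eqP->; apply: leq_addr. Qed.

Lemma wle_len_eq x y : wle x y -> len y <= len x -> x = y.
Proof.
move=> /eqP-> le; apply: (mulgI x^-1); rewrite mulVg; apply/esym/eqP.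
by rewrite -len_eq0; len_lia.
Qed.

Lemma wle_trans y x z : wle x y -> wle y z -> wle x z.
Proof.
move=> /eqP xy /eqP yz; apply/eqP.
have := len_mul (x^-1 * y) (y^-1 * z); rewrite mulgA mulgK.
by have := len_mul x (x^-1 * z); rewrite mulVKg; len_lia.
Qed.

Lemma wle_anti x y : wle x y -> wle y x -> x = y.
Proof. by move=> xy /wle_len; apply: wle_len_eq. Qed.

(** With its converse [wle_mulK], this makes multiplication by [z] an isomorphism from the interval
    [[1, y]] onto [[z, z * y]]. *)
Lemma wle_mull z x y : wle z (z * y) -> wle x y ->
  wle z (z * x) /\ wle (z * x) (z * y).
Proof.
rewrite !wleE /wle invgM -mulgA mulKg => /eqP zy /eqP xy.
have := len_mul z x; have := len_mul (z * x) (x^-1 * y); rewrite mulgA mulgK.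
by split; apply/eqP; len_lia.
Qed.

Lemma wle_mulK z x y : wle z (z * x) -> wle (z * x) (z * y) ->
  wle z (z * y) /\ wle x y.
Proof.
move=> zx zxy; have := wle_trans zx zxy; split=> //.
move: zx zxy (len_mul x (x^-1 * y)) (len_mul z y).
rewrite !wleE /wle invgM -mulgA mulKg mulVKg => /eqP zx /eqP zxy.
by move=> ? ?; apply/eqP; len_lia.
Qed.

Lemma wle_quotient z x g : wle z g -> wle x (z^-1 * g) ->
  wle z (z * x) /\ wle (z * x) g.
Proof. by move=> zg xg; have [] := @wle_mull z x (z^-1 * g); rewrite ?mulVKg. Qed.

Lemma wle_quotientK z x g : wle z (z * x) -> wle (z * x) g -> wle x (z^-1 * g).
Proof. by move=> zx xg; have [] := @wle_mulK z x (z^-1 * g); rewrite ?mulVKg. Qed.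

Lemma descent_wle i w : descent i w = wle (s i) w.
Proof.
rewrite /wle gwV len_gw /descent; have := len_gwM i w.
by case: ifP => lt; have := len_gw_neq i w; len_lia.
Qed.

Lemma descent_ex w : w != 1 -> exists i, descent i w.
Proof.
have := size_red w; have := ew_red w.
case: (red w) => [|i p] /= <-; rewrite ?ew_nil ?eqxx // => len_w _.
by exists i; rewrite /descent -len_w ew_cons gwK ltnS len_ew.
Qed.

(** The reflection [s i] is crossed by [x * y] but not by [x], so it is met inside [y], where
    exchange deletes a letter. *)
Lemma descent_mul i x y : descent i (x * y) -> ~~ descent i x ->
  exists2 y', s i * (x * y) = x * y' & len y' < len y.
Proof.
rewrite -{1}[x]ew_red -{1}[y]ew_red -ew_cat descent_crosses crosses_cat ew_red.
rewrite -descent_crosses ew_red => cross /negbTE ndi; move: cross.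
rewrite ndi => /crosses_del[p1 [j [p2 [def_y eq_y]]]].
exists (e (p1 ++ p2)).
  by rewrite -eq_y ew_red !mulgA mulgV mul1g.
rewrite -(size_red y) def_y; apply: (leq_ltn_trans (len_ew _ _)).
by rewrite !size_cat addnS.
Qed.

Hypothesis m_diag : forall i, m i i = 1%N.
Hypothesis m_sym : forall i j, m i j = m j i.
Hypothesis m_ge2 : forall i j, i != j -> 2 <= m i j.

(** Otherwise [s j] is a reflection [e (alt i j l.*2.+1)] with [l < k]; then an alternating word of
    size [l.+1 + l.+1] spells [1], against [ew_alt_neq]. *)
Lemma descent_alt i j k : k < m i j -> descent j (e (alt i j k)) -> False.
Proof.
move=> k_lt; rewrite descent_crosses crosses_alt.
have [/existsP[l /eqP jl] _|/existsPn none] :=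
    boolP [exists l : 'I_k, s j == e (alt i j l.*2.+1)]; last first.
  by rewrite big1 // => l _; apply: negbTE.
have: e (alt j i (l.+1 + l.+1)) = 1.
  by rewrite addSn addnS addnn alt_cons ew_cons -jl gw_sq.
have := alt_rev i j l.+1; have := alt_rev j i l.+1.
rewrite alt_cat ew_cat; case: ifP => _ rev1 _ eq1.
  apply: (@ew_alt_neq _ m m_diag m_sym m_ge2 i j l.+1); first by have := ltn_ord l; len_lia.
  by rewrite -(mulg1_eq eq1) -ew_rev rev1.
apply: (@ew_alt_neq _ m m_diag m_sym m_ge2 i j l.+1); first by have := ltn_ord l; len_lia.
by rewrite -rev1 ew_rev (mulg1_eq eq1).
Qed.

(** An alternating prefix of [g] shorter than [m i j] lacks one of the two descents of [g]. Exchange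
    then deletes a letter of the complement, and the prefix grows on the left. *)
Lemma wle_alt i j g k : i != j -> descent i g -> descent j g -> k <= m i j ->
  [/\ len (e (alt i j k)) = k, len (e (alt j i k)) = k,
      wle (e (alt i j k)) g & wle (e (alt j i k)) g].
Proof.
move=> ij di dj; elim: k => [|k IH] k_lt; first by rewrite ew_nil len1 wle1.
have [len_ij len_ji le_ij le_ji] := IH (ltnW k_lt).
have step a b : k < m a b -> len (e (alt a b k)) = k -> wle (e (alt a b k)) g ->
    descent b g -> len (e (alt b a k.+1)) = k.+1 /\ wle (e (alt b a k.+1)) g.
  move=> lt_k len_k le_k db; rewrite alt_cons ew_cons.
  have ndb: ~~ descent b (e (alt a b k)) by apply/negP/(descent_alt lt_k).
  have len_k1 : len (s b * e (alt a b k)) = k.+1.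
    by rewrite len_gwM; move: ndb; rewrite /descent => /negbTE->; rewrite len_k.
  split=> //; rewrite -(mulVKg (e (alt a b k)) g) in db.
  have [y' eq_y lt_y] := descent_mul db ndb.
  rewrite mulVKg in eq_y; move: le_k; rewrite /wle len_k len_k1 invgM gwV -mulgA eq_y mulKg.
  have := len_mul (s b * e (alt a b k)) y'; rewrite -mulgA -eq_y gwK len_k1.
  by move=> ? /eqP ?; apply/eqP; len_lia.
have [] := step i j k_lt len_ij le_ij dj; have [] := step j i _ len_ji le_ji di.
  by rewrite m_sym.
by split.
Qed.

Variable w0 : W.
Hypothesis w0_max : forall w, len w <= len w0.

Lemma descent_w0 i : descent i w0.
Proof. by rewrite /descent ltn_neqAle len_gw_neq w0_max. Qed.

(** Write [x = s i * y] with [y] shorter. As [i] is a descent of [w0] but not of [y], exchange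
    deletes a letter of [y^-1 * w0]. *)
Lemma wle_w0 x : wle x w0.
Proof.
have [n] := ubnP (len x); elim: n x => // n IH x; rewrite ltnS => le_x.
have [->|/descent_ex[i di]] := eqVneq x 1; first exact: wle1.
have lt_sx := di; rewrite /descent in lt_sx.
have {IH} := IH _ (leq_trans lt_sx le_x); set y := s i * x => le_y.
have ndi : ~~ descent i y by rewrite /descent /y gwK -leqNgt ltnW.
have := descent_w0 i; rewrite -(mulVKg y w0) => /descent_mul/(_ ndi)[z].
rewrite mulVKg => eq_z lt_z; rewrite /wle.
have eq_xz : x^-1 * w0 = z.
  by rewrite -[w0](gwK i) eq_z /y -(mulgA (s i)) gwK mulKg.
have := len_mul x z; rewrite -eq_xz mulVKg eq_xz.
move/eqP: le_y; move: (len_gwM i x); rewrite lt_sx -/y.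
by move=> ? ? ?; apply/eqP; len_lia.
Qed.

Lemma len_Vw0 x : len (x^-1 * w0) = len w0 - len x.
Proof. by have /eqP := wle_w0 x; len_lia. Qed.

Lemma len_mulw0 x : len (x * w0) = len w0 - len x.
Proof. by rewrite -{1}[x]invgK len_Vw0 lenV. Qed.

Lemma w0_sq : w0 * w0 = 1.
Proof. by apply/eqP; rewrite -len_eq0 len_mulw0 subnn. Qed.

Lemma w0V : w0^-1 = w0.
Proof. exact: mulg1_eq w0_sq. Qed.

Lemma len_w0mul x : len (w0 * x) = len w0 - len x.
Proof. by rewrite -lenV invgM w0V len_Vw0. Qed.

Lemma wle_w0r x y : wle x y -> wle (y * w0) (x * w0).
Proof.
move=> le_xy; have := wle_len le_xy; have := w0_max y; move: le_xy => /eqP xy.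
rewrite /wle !len_mulw0 invgM w0V -!mulgA len_w0mul mulgA len_mulw0.
rewrite -(lenV (y^-1 * x)) invgM invgK.
by move=> ? ?; have := w0_max (x^-1 * y); move=> ?; apply/eqP; len_lia.
Qed.

Definition is_join z x y :=
  [/\ wle x z, wle y z & forall g, wle x g -> wle y g -> wle z g].

(* Upwards induction from [w0] along covers: the join of two covers of [z] is
   reached through the longest element of the dihedral parabolic. *)
Lemma join_above n z x y : len w0 - len z < n -> wle z x -> wle z y ->
  exists t, is_join t x y.
Proof.
elim: n z x y => // n IH z x y lt_n zx zy.
have [eq_zx|neq_x] := eqVneq (z^-1 * x) 1.
  exists y; rewrite -(mulVKg z x) eq_zx mulg1; split=> //; exact: wle_refl.
have [eq_zy|neq_y] := eqVneq (z^-1 * y) 1.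
  by exists x; rewrite -(mulVKg z y) eq_zy mulg1; split=> //; exact: wle_refl.
have cover t : wle z t -> z^-1 * t != 1 -> exists i,
    [/\ wle z (z * s i), wle (z * s i) t & len w0 - len (z * s i) < n].
  move=> zt /descent_ex[i]; rewrite descent_wle => dt; exists i.
  have [le1 le2] := wle_quotient zt dt; split=> //; move: le1; rewrite wleE len_gw => /eqP le1.
  by have := w0_max (z * s i); len_lia.
have [i [z_i i_x lt_i]] := cover x zx neq_x.
have [j [z_j j_y lt_j]] := cover y zy neq_y.
have [eq_ij|ij] := eqVneq i j; first by apply: (IH _ _ _ lt_i) => //; rewrite eq_ij.
pose u := e (alt i j (m i j)).
(* A common upper bound of the two covers lies above [z * u], with [u] the longest element of the
   dihedral subgroup. *)
have below g : wle (z * s i) g -> wle (z * s j) g ->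
    wle z (z * u) /\ wle (z * u) g.
  move=> ig jg; have zg := wle_trans z_i ig.
  have := wle_quotientK z_i ig; have := wle_quotientK z_j jg.
  rewrite -!descent_wle => gj gi; have [_ _ le_u _] := wle_alt ij gi gj (leqnn _).
  exact: wle_quotient.
have [z_u _] := below w0 (wle_w0 _) (wle_w0 _).
have [u_i u_j] : wle (z * s i) (z * u) /\ wle (z * s j) (z * u).
  have desc a b : a != b -> wle (s a) (e (alt a b (m a b))).
    move=> ab; rewrite -descent_wle /descent.
    have [len_ab _ _ _] := wle_alt ab (descent_w0 a) (descent_w0 b) (leqnn _).
    rewrite len_ab; have := m_ge2 ab; case: (m a b) => [//|k] _.
    by rewrite alt_cons ew_cons gwK ltnS (leq_trans (len_ew _ _)) ?size_alt.
  split; first by case: (wle_mull z_u (desc i j ij)).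
  suff le_ju : wle (s j) u by case: (wle_mull z_u le_ju).
  by rewrite /u ew_braid m_sym desc // eq_sym.
(* First [x] is joined with [z * u] above one cover, then [y] with the result above the other. *)
have [v [v_x v_u v_min]] := IH _ _ _ lt_i i_x u_i.
have [t [t_y t_v t_min]] := IH _ _ _ lt_j j_y (wle_trans u_j v_u).
exists t; split=> // [|g gx gy]; first exact: wle_trans v_x t_v.
apply: t_min => //; apply: v_min => //; apply: (proj2 (below _ _ _)).
  exact: wle_trans i_x gx.
exact: wle_trans j_y gy.
Qed.

Lemma join_ex x y : exists t, is_join t x y.
Proof. exact: (@join_above _ 1 x y (ltnSn _) (wle1 x) (wle1 y)). Qed.

Definition wjoin x y := epsilon (inhabits 1) (fun z => is_join z x y).

Lemma wjoinP x y : is_join (wjoin x y) x y.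
Proof. exact: epsilon_spec (join_ex x y). Qed.

(* The largest [x <= w] such that the product [v x] is length-additive. *)
Definition ext v w := wjoin (w * w0) (v^-1 * w0 * w0) * w0.

(** Additivity of [v * x] means [wle x (v^-1 * w0)], so [ext v w] is the meet of [w] and
    [v^-1 * w0]; right multiplication by [w0] reverses the order and turns joins into meets. *)
Lemma extP v w x : wle x (ext v w) <-> wle x w /\ wle v (v * x).
Proof.
have ww0 y : y * w0 * w0 = y by rewrite -mulgA w0_sq mulg1.
have [le_w le_v min] := wjoinP (w * w0) (v^-1 * w0 * w0).
have -> : wle v (v * x) <-> wle x (v^-1 * w0).
  rewrite wleE /wle mulgA -invgM !len_Vw0.
  have := w0_max (v * x); have := w0_max v; have := w0_max x; have := len_mul v x.
  by split=> /eqP ?; apply/eqP; len_lia.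
split=> [le_x|[le_xw le_xv]].
  by split; apply: wle_trans le_x _; rewrite /ext -[X in wle _ X]ww0; apply: wle_w0r.
by rewrite -[x]ww0; apply/wle_w0r/min; rewrite ?ww0; [|rewrite -[v^-1]ww0]; apply: wle_w0r.
Qed.

End WeakOrder.

(** * The positive monoid *)
Section BraidMonoid.
Local Open Scope group_scope.
Variables (I : finType) (m : I -> I -> nat).

Inductive braid_rel : seq I -> seq I -> Prop :=
  Braid_rel i j : braid_rel (alt i j (m i j)) (alt j i (m i j)).

Definition braid := presented braid_rel.
HB.instance Definition _ := Monoid.on braid.

Definition bw (p : seq I) : braid := cls braid_rel p.

Lemma bw_cat p q : bw (p ++ q) = bw p * bw q. Proof. exact: cls_cat. Qed.

Lemma bw_nil : bw [::] = 1. Proof. by []. Qed.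

Definition bg (i : I) : braid := bw [:: i].

Lemma bw_cons i p : bw (i :: p) = bg i * bw p. Proof. exact: (bw_cat [:: i]). Qed.

Lemma bw_surj x : exists p, bw p = x.
Proof. by exists (word_of x); apply: word_ofK. Qed.

Lemma bw_braid i j : bw (alt i j (m i j)) = bw (alt j i (m i j)).
Proof. by apply/clsP/cong_rel; constructor. Qed.

Lemma bw_invariant X (f : seq I -> X) :
  (forall u i j v, f (u ++ alt i j (m i j) ++ v) = f (u ++ alt j i (m i j) ++ v)) ->
  forall p q, bw p = bw q -> f p = f q.
Proof.
move=> fbraid p q /clsP; apply: (cong_invariant (E := eq)) => //.
- by move=> ? ? ? -> ->.
- by move=> u v l r [i j]; rewrite fbraid.
Qed.

Local Notation W := (coxeter m).
Local Notation e := (ew m).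
Local Notation s := (gw m).
Local Notation len := (@len I m).
Implicit Types (i j : I) (p q : seq I) (t u v w : W) (x y z g : braid).

Hypothesis m_diag : forall i, m i i = 1%N.
Hypothesis m_sym : forall i j, m i j = m j i.
Hypothesis m_ge2 : forall i j, i != j -> 2 <= m i j.

Lemma reduced_cons i p : size (i :: p) = len (e (i :: p)) ->
  size p = len (e p) /\ wle (s i) (s i * e p).
Proof.
rewrite wleE len_gw ew_cons /= => eq_len; have := len_mul (s i) (e p).
have := len_ew m p; rewrite len_gw -eq_len => ? ?.
by split; [|apply/eqP]; lia.
Qed.

(** If the first letters [i] and [j] differ, the common value has the dihedral longest element as a
    prefix. By induction each word equals one side of the braid relation followed by the same
    [c]. *)
Lemma matsumoto p q : size p = len (e p) -> size q = len (e q) -> e p = e q ->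
  bw p = bw q.
Proof.
have [n] := ubnP (size p); elim: n p q => // n IH [|i p] [|j q] lt_n red_p red_q eq_pq //.
- by move: red_q; rewrite -eq_pq -red_p.
- by move: red_p; rewrite eq_pq -red_q.
have [red_p' ip] := reduced_cons red_p; have [red_q' jq] := reduced_cons red_q.
have cancel_head k a b : (size a < n)%N -> size (k :: a) = len (e (k :: a)) ->
    size (k :: b) = len (e (k :: b)) -> e (k :: a) = e (k :: b) ->
    bw (k :: a) = bw (k :: b).
  move=> lt_a red_a red_b; rewrite !ew_cons => /mulgI eq_ab.
  by rewrite !bw_cons (IH a b) //; [case: (reduced_cons red_a)|case: (reduced_cons red_b)].
have [eq_ij|ij] := eqVneq i j; first by move: eq_ij red_q eq_pq => <- ? ?; apply: cancel_head.
pose c := red ((e (alt i j (m i j)))^-1 * e (i :: p)).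
have di : descent i (e (i :: p)) by rewrite descent_wle ew_cons.
have dj : descent j (e (i :: p)) by rewrite eq_pq descent_wle ew_cons.
have [len_ij len_ji le_ij le_ji] := wle_alt m_diag m_sym m_ge2 ij di dj (leqnn _).
have ew_c : e (alt i j (m i j) ++ c) = e (i :: p).
  by rewrite ew_cat ew_red mulVKg.
have size_c : size (alt i j (m i j) ++ c) = size (i :: p).
  by rewrite size_cat size_alt size_red red_p; move: le_ij; rewrite /wle len_ij => /eqP.
have eq_size : size p = size q by have := red_q; rewrite -eq_pq -red_p => -[].
have [k def_alt] : exists k, forall a b : I, alt a b (m i j) = a :: alt b a k.
  by have := m_ge2 ij; case: (m i j) => // k _; exists k; move=> a b; rewrite alt_cons.
have -> : bw (i :: p) = bw (alt i j (m i j) ++ c).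
  move: ew_c size_c; rewrite def_alt cat_cons => ew_c size_c.
  by apply: cancel_head; rewrite ?ew_c ?size_c.
have -> : bw (j :: q) = bw (alt j i (m i j) ++ c).
  have ew_c' : e (alt j i (m i j) ++ c) = e (i :: p) by rewrite ew_cat -ew_braid -ew_cat.
  have size_c' : size (alt j i (m i j) ++ c) = size (i :: p).
    by rewrite -size_c !size_cat !size_alt.
  move: ew_c' size_c'; rewrite def_alt cat_cons => ew_c' size_c'.
  apply: cancel_head => //; first by rewrite -eq_size.
    by rewrite ew_c' -red_p -size_c'.
  by rewrite -eq_pq -ew_c'.
by rewrite !bw_cat bw_braid.
Qed.

Definition atom_of w : braid := bw (red w).

Lemma atom_of_ew p : size p = len (e p) -> atom_of (e p) = bw p.
Proof. by move=> red_p; apply: matsumoto; rewrite ?ew_red ?size_red. Qed.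

Lemma atom_of1 : atom_of 1 = 1.
Proof. by rewrite -ew_nil atom_of_ew // ew_nil len1. Qed.

Lemma atom_of_gw i : atom_of (s i) = bg i.
Proof. by rewrite atom_of_ew // len_gw. Qed.

Lemma atom_of_mul u v : wle u (u * v) -> atom_of (u * v) = atom_of u * atom_of v.
Proof.
rewrite wleE => /eqP len_uv; rewrite -bw_cat -atom_of_ew ew_cat !ew_red //.
by rewrite size_cat !size_red.
Qed.

Lemma atom_of_quotient u w : wle u w -> atom_of w = atom_of u * atom_of (u^-1 * w).
Proof. by move=> uw; rewrite -atom_of_mul mulVKg. Qed.

Variable w0 : W.
Hypothesis w0_max : forall w, len w <= len w0.
Local Notation ext := (ext w0).
Local Notation extP := (extP m_diag m_sym m_ge2 w0_max).

Lemma ext_self v w : wle (ext v w) w /\ wle v (v * ext v w).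
Proof. by apply/extP/wle_refl. Qed.

Lemma ext1 w : ext 1 w = w.
Proof.
apply: wle_anti; first by case: (ext_self 1 w).
by apply/extP; split; [apply: wle_refl | apply: wle1].
Qed.

Lemma ext_w0 w : ext w0 w = 1.
Proof.
have [_ le_w0] := ext_self w0 w; apply: (mulgI w0); rewrite mulg1; apply/esym.
exact: wle_len_eq le_w0 (w0_max _).
Qed.

(** This makes [bstep] below multiplicative along reduced words: absorbing with [v] and then with
    [u] is absorbing with [u * v]. *)
Lemma ext_mul u v w : wle u (u * v) ->
  ext u (v * ext v w) = v * ext (u * v) w /\ wle (ext (u * v) w) (ext v w).
Proof.
move=> uv; set x0 := ext (u * v) w; set x1 := ext v w; set y := ext u (v * x1).
have [x0w uvx0] := ext_self (u * v) w; rewrite -/x0 -mulgA in uvx0 x0w.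
have [x1w vx1] := ext_self v w; rewrite -/x1 in vx1 x1w.
have [yvx1 uy] := ext_self u (v * x1); rewrite -/y in yvx1 uy.
have [_ vx0] := wle_mulK uv uvx0.
have x01 : wle x0 x1 by apply/extP.
split=> //; apply: wle_anti; last first.
  by apply/extP; split; [case: (wle_mull vx1 x01) | apply: wle_trans uv uvx0].
have vy : wle v y by apply/extP.
rewrite -(mulVKg v y) in yvx1 uy vy *.
have [_ x1y] := wle_mulK vy yvx1.
suff : wle (v^-1 * y) x0 by case/(wle_mull vx0).
apply/extP; split; first exact: wle_trans x1y x1w.
by rewrite -mulgA; case: (wle_mull uy vy).
Qed.

(* The normal form automaton: multiplying [w * x], with [w] the simple head,
   by a generator on the left. *)
Definition bstep i (a : W * braid) : W * braid :=
  (s i * ext (s i) a.1, atom_of ((ext (s i) a.1)^-1 * a.1) * a.2).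

Definition brun p a := foldr bstep a p.

Lemma brun_cat p q a : brun (p ++ q) a = brun p (brun q a).
Proof. exact: foldr_cat. Qed.

Lemma brun_reduced p a : size p = len (e p) ->
  brun p a = (e p * ext (e p) a.1, atom_of ((ext (e p) a.1)^-1 * a.1) * a.2).
Proof.
case: a => w x; elim: p => [_|i p IH red_ip] /=.
  by rewrite ew_nil ext1 mul1g mulVg atom_of1 mul1g.
have [red_p ip] := reduced_cons red_ip; rewrite (IH red_p) /bstep /= ew_cons.
have [-> le_ext] := ext_mul w ip; congr (_, _); first by rewrite mulgA.
rewrite [LHS]mulgA; congr (_ * _).
set x0 := ext _ w in le_ext *; set x1 := ext _ w in le_ext *.
have [x1w _] := ext_self (e p) w; rewrite -/x1 in x1w.
have -> : (e p * x0)^-1 * (e p * x1) = x0^-1 * x1 by rewrite invgM -mulgA mulKg.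
have eq_w : x0^-1 * x1 * (x1^-1 * w) = x0^-1 * w by rewrite -mulgA mulVKg.
rewrite -atom_of_mul eq_w //.
by have [] := @wle_mulK _ _ x0 (x0^-1 * x1) (x0^-1 * w); rewrite !mulVKg.
Qed.

Lemma size_alt_reduced i j : i != j -> size (alt i j (m i j)) = len (e (alt i j (m i j))).
Proof.
move=> ij; have := wle_alt m_diag m_sym m_ge2 ij (descent_w0 w0_max i) (descent_w0 w0_max j).
by case/(_ _ (leqnn _)) => ->; rewrite size_alt.
Qed.

(** Both sides of a braid relation are reduced words of one element, and by [brun_reduced] the run
    of a reduced word depends only on its value. *)
Lemma brun_bw p q a : bw p = bw q -> brun p a = brun q a.
Proof.
apply: (bw_invariant (f := brun^~ a)) => u i j v; rewrite !brun_cat.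
have [->//|ij] := eqVneq i j.
have red_ij := size_alt_reduced ij; have red_ji := red_ij.
rewrite ew_braid size_alt in red_ji; rewrite !(brun_reduced _ red_ij) ew_braid.
by rewrite !(@brun_reduced (alt j i _)) ?size_alt.
Qed.

(** A state [(w, x)] stands for the product [atom_of w * x]. *)
Lemma atom_of_brun p a : atom_of (brun p a).1 * (brun p a).2 = bw p * (atom_of a.1 * a.2).
Proof.
elim: p => [|i p IH] /=; first by rewrite bw_nil mul1g.
case: (brun p a) IH => w x /= IH; have [xw ix] := ext_self (s i) w.
by rewrite bw_cons -mulgA -IH atom_of_mul // atom_of_gw (atom_of_quotient xw) !mulgA.
Qed.

Definition bdvd x y := exists z, y = x * z.

Lemma bdvd_refl x : bdvd x x. Proof. by exists 1; rewrite mulg1. Qed.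

Lemma bdvd_trans y x z : bdvd x y -> bdvd y z -> bdvd x z.
Proof. by move=> [a ->] [b ->]; exists (a * b); rewrite mulgA. Qed.

Lemma bdvd_mull z x y : bdvd x y -> bdvd (z * x) (z * y).
Proof. by case=> a ->; exists a; rewrite mulgA. Qed.

Lemma bdvd_mulr x y : bdvd x (x * y). Proof. by exists y. Qed.

Definition simple_head x : W := (brun (word_of x) (1, 1)).1.

(** If [atom_of v] divides [x], running a word of the cofactor and then a reduced word of [v] leaves
    a head [v * ext v w], of which [v] is a prefix. *)
Lemma simple_headP v x : bdvd (atom_of v) x <-> wle v (simple_head x).
Proof.
rewrite /simple_head; split=> [[z eq_x]|le_v].
  have -> := @brun_bw (word_of x) (red v ++ word_of z) (1, 1).
    rewrite brun_cat brun_reduced ?ew_red ?size_red //=; case: (brun _ _) => w y /=.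
    by case: (ext_self v w).
  by rewrite bw_cat -/(atom_of v) /bw !word_ofK.
have := atom_of_brun (word_of x) (1, 1); rewrite /= atom_of1 !mulg1 /bw word_ofK => <-.
by rewrite (atom_of_quotient le_v) -mulgA; apply: bdvd_mulr.
Qed.

Definition bdelta := atom_of w0.

(** Since [ext w0 w] is [1], running [bdelta] resets the head to [w0] and moves the old head into
    the tail, which then holds the other factor. *)
Lemma bdelta_mulI x y : bdelta * x = bdelta * y -> x = y.
Proof.
have [p <-] := bw_surj x; have [q <-] := bw_surj y; rewrite -!bw_cat.
have tailE k : (brun (red w0 ++ k) (1, 1)).2 = bw k.
  rewrite brun_cat brun_reduced ?ew_red ?size_red //= ext_w0 invg1 mul1g.
  by rewrite atom_of_brun /= atom_of1 !mulg1.
by move=> /(@brun_bw _ _ (1, 1)) /(congr1 snd); rewrite !tailE.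
Qed.

Lemma bg_left_div i : bdelta = atom_of (w0 * s i) * bg i.
Proof.
rewrite -atom_of_gw -atom_of_mul -mulgA ?gw_sq ?mulg1 //.
rewrite -[X in wle _ X]mulg1 -(gw_sq m i) mulgA wleE -mulgA gw_sq mulg1 len_gw.
rewrite (len_w0mul w0_max) len_gw.
by have := w0_max (s i); rewrite len_gw; lia.
Qed.

Lemma bg_right_div i : bdvd (bg i) bdelta.
Proof.
rewrite -atom_of_gw; exists (atom_of ((s i)^-1 * w0)); apply: atom_of_quotient.
exact: wle_w0.
Qed.

(** Each generator is completed on the left to [bdelta], which cancels. *)
Lemma bmulI x y z : x * y = x * z -> y = z.
Proof.
have [p <-] := bw_surj x; elim: p => [|i p IH]; first by rewrite bw_nil !mul1g.
have def_c := bg_left_div i; set c := atom_of _ in def_c.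
rewrite bw_cons -!mulgA => /(congr1 ( *%g c)); rewrite !mulgA -def_c -!mulgA.
by move/bdelta_mulI/IH.
Qed.

Lemma gw_conj_ex i : exists2 j, s j * w0 = w0 * s i & s i * w0 = w0 * s j.
Proof.
have w0_sq := w0_sq w0_max.
have len1c : len (w0 * s i * w0) = 1%N.
  rewrite (len_mulw0 w0_max) (len_w0mul w0_max).
  by have := w0_max (s i); rewrite len_gw; lia.
have := size_red (w0 * s i * w0); have := ew_red (w0 * s i * w0); rewrite len1c.
case: (red _) => [|j []] // def_j _; rewrite -/(s j) in def_j; exists j.
  by rewrite def_j -mulgA w0_sq mulg1.
by rewrite def_j !mulgA w0_sq mul1g.
Qed.

Lemma bdelta_bg i j : s j * w0 = w0 * s i -> bdelta * bg i = bg j * bdelta.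
Proof.
move=> eq_j; have jw0 : wle (s j) w0 by apply: wle_w0.
have w0i : w0 = s j * w0 * s i by rewrite eq_j -mulgA gw_sq mulg1.
have w0ile : wle (s j * w0) (s j * w0 * s i).
  rewrite wleE -w0i eq_j (len_w0mul w0_max) len_gw.
  by have := w0_max (s i); rewrite len_gw; move=> ?; apply/eqP; lia.
rewrite /bdelta {1}(atom_of_quotient jw0) gwV atom_of_gw -mulgA; congr (_ * _).
by rewrite [in RHS]w0i (atom_of_mul w0ile) atom_of_gw.
Qed.

(** Conjugation by [bdelta] is an involution on the generators, so one [y] serves both equations;
    together they make [bdelta2] central. *)
Lemma bdelta_conj x : exists y, bdelta * x = y * bdelta /\ bdelta * y = x * bdelta.
Proof.
have [p <-] := bw_surj x; elim: p => [|i p [y [eq1 eq2]]].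
  by exists 1; rewrite bw_nil mulg1 mul1g.
have [j /bdelta_bg eq_j /bdelta_bg eq_i] := gw_conj_ex i.
exists (bg j * y); rewrite bw_cons; split.
  by rewrite mulgA eq_j -mulgA eq1 mulgA.
by rewrite mulgA eq_i -mulgA eq2 mulgA.
Qed.

Definition bdelta2 := bdelta * bdelta.

Lemma bdelta2C x : bdelta2 * x = x * bdelta2.
Proof.
have [y [eq1 eq2]] := bdelta_conj x.
by rewrite /bdelta2 -mulgA eq1 mulgA eq2 mulgA.
Qed.

(** Multiplication by [c * bdelta] turns the last letter into [bdelta2], which is central and
    cancels on the left. *)
Lemma bmulIr x y z : y * x = z * x -> y = z.
Proof.
have [p <-] := bw_surj x; elim/last_ind: p => [|p i IH]; first by rewrite bw_nil !mulg1.
have [c def_c] := bg_right_div i.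
rewrite -cats1 bw_cat -/(bg i) !mulgA => /(congr1 (fun a => a * (c * bdelta))).
rewrite /= !mulgA -!(mulgA _ (bg i)) -def_c -!(mulgA _ bdelta) -/bdelta2 -!bdelta2C.
by move/bmulI/IH.
Qed.

Definition blcm z x y :=
  [/\ bdvd x z, bdvd y z & forall g, bdvd x g -> bdvd y g -> bdvd z g].

(** The letters of [y] are consumed one by one, [u] being replaced by the quotient by [s i] of its
    join with [s i]. By [simple_headP], this join divides every common multiple. *)
Lemma blcm_simple u y : exists v, blcm (y * atom_of v) (atom_of u) y.
Proof.
have [p <-] := bw_surj y; elim: p u => [|i p IH] u.
  exists u; rewrite bw_nil mul1g; split=> //; first exact: bdvd_refl.
  by exists (atom_of u); rewrite mul1g.
have [le_u le_i min] := wjoinP m_diag m_sym m_ge2 w0_max u (s i).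
set t := wjoin _ _ in le_u le_i min; have [v [dvd_v dvd_p min_v]] := IH ((s i)^-1 * t).
have atom_of_t : atom_of t = bg i * atom_of ((s i)^-1 * t).
  by rewrite (atom_of_quotient le_i) atom_of_gw.
exists v; rewrite bw_cons -mulgA; split.
- apply: bdvd_trans (bdvd_mull _ dvd_v); rewrite -atom_of_t (atom_of_quotient le_u).
  exact: bdvd_mulr.
- by rewrite mulgA; apply: bdvd_mulr.
move=> g /simple_headP ug ipg; have [g' def_g] := ipg; rewrite -mulgA in def_g.
have /simple_headP ig : bdvd (atom_of (s i)) g by rewrite atom_of_gw def_g; apply: bdvd_mulr.
have /simple_headP[c eq_c] := min _ ug ig.
rewrite def_g; apply/bdvd_mull/min_v; last exact: bdvd_mulr.
by exists c; apply: (@bmulI (bg i)); rewrite -def_g eq_c atom_of_t mulgA.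
Qed.

(** The lcm of the first letter [i] of [x] with [y] has the form [bg i * y']; the induction
    continues with the rest of [x] and [y']. *)
Lemma blcm_ex x y : exists z, blcm z x y.
Proof.
have [p <-] := bw_surj x; elim: p y => [|i p IH] y.
  by exists y; rewrite bw_nil; split=> //; [exists y; rewrite mul1g | exact: bdvd_refl].
have [v [dvd_i dvd_y min_v]] := blcm_simple (s i) y; rewrite atom_of_gw in dvd_i min_v.
have [y' def_y] := dvd_i; rewrite def_y in dvd_y min_v.
have [z [dvd_p dvd_y' min]] := IH y'; exists (bg i * z); rewrite bw_cons; split.
- exact: bdvd_mull.
- exact: bdvd_trans dvd_y (bdvd_mull _ dvd_y').
move=> g dvd_ip dvd_yg; have [c] := dvd_ip; rewrite -mulgA => def_g.
rewrite def_g; apply/bdvd_mull/min; first exact: bdvd_mulr.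
have [|c' eq_c'] := min_v g _ dvd_yg; first by rewrite def_g; apply: bdvd_mulr.
by exists c'; apply: (@bmulI (bg i)); rewrite -def_g eq_c' mulgA.
Qed.

End BraidMonoid.

(** * The Artin group *)
Section ArtinGroup.
Local Open Scope group_scope.
Variables (I : finType) (m : I -> I -> nat).
Notation word := (seq (I * bool)).

Definition artin := presented (artin_rel m).
HB.instance Definition _ := Monoid.on artin.

Definition aw (w : word) : artin := cls (artin_rel m) w.

Lemma awP u v : aw u = aw v <-> aeq m u v. Proof. exact: clsP. Qed.

Lemma aw_cat u v : aw (u ++ v) = aw u * aw v. Proof. exact: cls_cat. Qed.

Lemma aw_nil : aw [::] = 1. Proof. by []. Qed.

Lemma aw_cons a u : aw (a :: u) = aw [:: a] * aw u. Proof. exact: (aw_cat [:: a]). Qed.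

Lemma aw_word (x : artin) : aw (word_of x) = x. Proof. exact: word_ofK. Qed.

Lemma aw_letterV i b : aw [:: (i, ~~ b)] * aw [:: (i, b)] = 1.
Proof.
by rewrite -aw_cat -{2}[b]negbK; apply/clsP/cong_rel; constructor.
Qed.

Lemma winv_cons a (w : word) : winv (a :: w) = rcons (winv w) (a.1, ~~ a.2).
Proof. by rewrite /winv /= rev_cons. Qed.

Lemma winvK : involutive (@winv I).
Proof.
move=> w; rewrite /winv map_rev revK -map_comp -[RHS]map_id.
by apply: eq_map => -[i b] /=; rewrite negbK.
Qed.

Lemma aw_winvM w : aw (winv w) * aw w = 1.
Proof.
elim: w => [|[i b] w IH]; first by rewrite mulg1.
by rewrite winv_cons /= -cats1 aw_cat (aw_cons _ w) mulgA -(mulgA (aw _)) aw_letterV mulg1.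
Qed.

Definition artin_inv (x : artin) := locked_with presented_key (aw (winv (word_of x))).

Lemma artin_mulVg : left_inverse 1 artin_inv *%g.
Proof. by move=> x; rewrite /artin_inv unlock -{2}(aw_word x) aw_winvM. Qed.

Lemma artin_mulgV : right_inverse 1 artin_inv *%g.
Proof.
move=> x; rewrite /artin_inv unlock -{1}(aw_word x) -{1}(winvK (word_of x)).
exact: aw_winvM.
Qed.

HB.instance Definition _ := hasInv.Build artin artin_inv.
HB.instance Definition _ := Monoid_isGroup.Build artin artin_mulVg artin_mulgV.

Lemma aw_winv w : aw (winv w) = (aw w)^-1.
Proof. by apply: (mulIg (aw w)); rewrite aw_winvM mulVg. Qed.

Lemma aw_invariant X (f : word -> X) :
  (forall u i b v, f (u ++ [:: (i, b), (i, ~~ b) & v]) = f (u ++ v)) ->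
  (forall u i j v, f (u ++ pw (alt i j (m i j)) ++ v) = f (u ++ pw (alt j i (m i j)) ++ v)) ->
  forall p q, aw p = aw q -> f p = f q.
Proof.
move=> ffree fbraid p q /awP; apply: (cong_invariant (E := eq)) => //.
- by move=> ? ? ? -> ->.
- by move=> u v l r [i b|i j]; [rewrite ffree | rewrite fbraid].
Qed.

Lemma pw_cat (p q : seq I) : pw (p ++ q) = pw p ++ pw q.
Proof. exact: map_cat. Qed.

Local Notation W := (coxeter m).
Local Notation e := (ew m).
Local Notation s := (gw m).
Local Notation len := (@len I m).
Local Notation B := (braid m).
Local Notation bw := (bw m).
Implicit Types (i : I) (b c : B) (x y z : artin).

Definition inA b : artin := aw (pw (word_of b)).

Lemma inA_bw p : inA (bw p) = aw (pw p).
Proof.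
apply: (bw_invariant (f := aw \o @pw I)); last exact: word_ofK.
move=> u i j v /=; rewrite !pw_cat !aw_cat; congr (_ * (_ * _)).
by apply/clsP/cong_rel; constructor.
Qed.

Lemma inA_mul b c : inA (b * c) = inA b * inA c.
Proof.
have [p <-] := bw_surj b; have [q <-] := bw_surj c.
by rewrite -bw_cat !inA_bw pw_cat aw_cat.
Qed.

Lemma inA1 : inA 1 = 1. Proof. by rewrite -bw_nil inA_bw. Qed.

Lemma inAX b n : inA (b ^+ n) = inA b ^+ n.
Proof. by elim: n => [|n IH]; rewrite ?inA1 // !expgS inA_mul IH. Qed.

Hypothesis m_diag : forall i, m i i = 1%N.
Hypothesis m_sym : forall i j, m i j = m j i.
Hypothesis m_ge2 : forall i j, i != j -> 2 <= m i j.
Variable w0 : W.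
Hypothesis w0_max : forall w, len w <= len w0.
Local Notation bdelta := (bdelta w0).
Local Notation bdelta2 := (bdelta2 w0).

(** An inverse letter is represented by its product with [bdelta2], which is positive by
    [bg_left_div]. *)
Definition bletter (a : I * bool) : B :=
  if a.2 then bg m a.1 else bdelta * atom_of (w0 * s a.1).

(* A word [w] represents the fraction [bdelta2 ^- den w * num w]. *)
Definition num (w : word) : B := foldr (fun a b => bletter a * b) 1 w.
Definition den (w : word) : nat := count (fun a => ~~ a.2) w.

Lemma num_cat u v : num (u ++ v) = num u * num v.
Proof. by elim: u => [|a u IH] /=; rewrite ?mul1g // IH mulgA. Qed.

Lemma num_pw p : num (pw p) = bw p.
Proof. by elim: p => [|i p IH] //=; rewrite IH bw_cons. Qed.

Lemma den_pw p : den (pw p) = 0.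
Proof. by elim: p. Qed.

Lemma bdelta2XC n b : bdelta2 ^+ n * b = b * bdelta2 ^+ n.
Proof.
by apply: commute_sym; apply: commuteX; apply: commute_sym; apply: bdelta2C.
Qed.

Lemma bletter_mul i (c : bool) : bletter (i, c) * bletter (i, ~~ c) = bdelta2.
Proof.
have right : bletter (i, false) * bletter (i, true) = bdelta2.
  by rewrite /bletter /= -mulgA -bg_left_div.
case: c => //=; apply: (@bmulIr _ _ m_diag m_sym m_ge2 _ w0_max (bletter (i, true))).
by rewrite -mulgA right bdelta2C.
Qed.

Definition fraction_eq u v :=
  bdelta2 ^+ den v * num u = bdelta2 ^+ den u * num v.

(** Transitivity comes from left cancellation. A cancelling pair has numerator [bdelta2] and one
    inverse letter, so it is the fraction [1]. *)
Lemma aeq_fraction u v : aw u = aw v -> fraction_eq u v.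
Proof.
move=> /awP; apply: (cong_invariant (E := fraction_eq) (f := id)) => //.
  move=> {}u {}v w; rewrite /fraction_eq => uv vw.
  apply: (@bmulI _ _ m_diag m_sym m_ge2 _ w0_max (bdelta2 ^+ den v)).
  by rewrite mulgA -expgnDr addnC expgnDr -mulgA uv mulgA -expgnDr addnC expgnDr -mulgA
    vw mulgA -expgnDr addnC expgnDr -mulgA.
move=> {}u {}v l r rel.
have : bdelta2 ^+ den r * num l = bdelta2 ^+ den l * num r.
  case: rel => [i c|i j]; last by rewrite !den_pw !num_pw bw_braid.
  rewrite /= !mulg1 mul1g bletter_mul addn0.
  by case: c.
rewrite /fraction_eq /den !count_cat -!/(den _) !num_cat => eq_lr.
rewrite [(den r + _)%N]addnC [(den l + _)%N]addnC !addnA !expgnDr -!mulgA.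
by congr (_ * (_ * _)); rewrite !mulgA !bdelta2XC -!(mulgA (num u)) eq_lr.
Qed.

(** Positive words have exponent [den] zero, so equal fractions have equal numerators. *)
Lemma inA_inj b c : inA b = inA c -> b = c.
Proof.
have [p <-] := bw_surj b; have [q <-] := bw_surj c.
by rewrite !inA_bw => /aeq_fraction; rewrite /fraction_eq !den_pw !mul1g !num_pw.
Qed.

Definition delta := inA bdelta.

Lemma delta_conj b : exists c, delta * inA b = inA c * delta /\ inA b * delta = delta * inA c.
Proof.
have [c [eq1 eq2]] := bdelta_conj m_diag m_sym m_ge2 w0_max b.
by exists c; rewrite -!inA_mul eq1 eq2.
Qed.

Lemma delta2_letter i (c : bool) : exists2 b, delta * delta * aw [:: (i, c)] = inA b &
   aw [:: (i, c)] * (delta * delta) = inA b.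
Proof.
have eq_t : aw [:: (i, true)] = inA (bg m i) by rewrite inA_bw.
case: c.
  exists (bdelta2 * bg m i); first by rewrite !inA_mul eq_t.
  by rewrite (bdelta2C m_diag m_sym m_ge2 w0_max) !inA_mul eq_t.
have eq_f : aw [:: (i, false)] = (inA (bg m i))^-1.
  by rewrite -eq_t -aw_winv.
have := bletter_mul i true; have := bletter_mul i false; rewrite /=.
move=> eq1 eq2; exists (bletter (i, false)); rewrite -inA_mul -/bdelta2 eq_f.
  by rewrite -eq1 inA_mul mulgK.
by rewrite -eq2 inA_mul mulKg.
Qed.

Lemma delta2C x : delta * delta * x = x * (delta * delta).
Proof.
rewrite -[x]aw_word; elim: (word_of x) => [|[i c] w IH]; first by rewrite mulg1 mul1g.
have [b eq1 eq2] := delta2_letter i c.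
by rewrite aw_cons mulgA eq1 -eq2 -!mulgA -IH !mulgA.
Qed.

Lemma delta2XC n x : (delta * delta) ^+ n * x = x * (delta * delta) ^+ n.
Proof.
by apply: commute_sym; apply: commuteX; apply: commute_sym; apply: delta2C.
Qed.

Lemma artin_fraction x : exists n b, (delta * delta) ^+ n * x = inA b.
Proof.
rewrite -[x]aw_word; elim: (word_of x) => [|[i c] w [n [b eq_w]]].
  by exists 0, 1; rewrite mul1g inA1.
have [b' eq_b' _] := delta2_letter i c; exists n.+1, (b' * b).
rewrite (aw_cons _ w) mulgA expgS inA_mul -eq_b' -eq_w.
rewrite -(mulgA (delta * delta) _ (aw [:: (i, c)])) (delta2XC _ (aw [:: (i, c)])) mulgA.
by rewrite -(mulgA _ _ (aw w)).
Qed.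

Definition ale x y := exists b, y = x * inA b.

Lemma ale_refl x : ale x x. Proof. by exists 1; rewrite inA1 mulg1. Qed.

Lemma ale_trans y x z : ale x y -> ale y z -> ale x z.
Proof. by move=> [b ->] [c ->]; exists (b * c); rewrite inA_mul mulgA. Qed.

Lemma ale_mull z x y : ale x y -> ale (z * x) (z * y).
Proof. by move=> [b ->]; exists b; rewrite mulgA. Qed.

Lemma ale_inA b c : ale (inA b) (inA c) <-> bdvd b c.
Proof.
by split=> -[a]; [rewrite -inA_mul => /inA_inj | move=> ->; rewrite inA_mul]; exists a.
Qed.

Definition alub z x y :=
  [/\ ale x z, ale y z & forall t, ale x t -> ale y t -> ale z t].

(** A common power [D] of the central [delta * delta] makes both elements positive; their lcm is
    translated back by [D^-1]. *)
Lemma alub_ex x y : exists z, alub z x y.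
Proof.
have [n [b eq_b]] := artin_fraction x; have [k [c eq_c]] := artin_fraction y.
pose D := (delta * delta) ^+ (k + n).
have eq_x : D * x = inA (bdelta2 ^+ k * b).
  by rewrite /D expgnDr -mulgA eq_b inA_mul inAX inA_mul.
have eq_y : D * y = inA (bdelta2 ^+ n * c).
  by rewrite /D addnC expgnDr -mulgA eq_c inA_mul inAX inA_mul.
have [a [xa ya min]] :=
  blcm_ex m_diag m_sym m_ge2 w0_max (bdelta2 ^+ k * b) (bdelta2 ^+ n * c).
have scale t u : ale (D * t) u -> ale t (D^-1 * u).
  by move/(ale_mull D^-1); rewrite mulKg.
exists (D^-1 * inA a); split=> [||t xt yt].
- by apply: scale; rewrite eq_x ale_inA.
- by apply: scale; rewrite eq_y ale_inA.
have [g eq_g] := ale_mull D xt; rewrite eq_x -inA_mul in eq_g.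
rewrite -(mulKg D t); apply: ale_mull; rewrite eq_g ale_inA; apply: min.
  exact: bdvd_mulr.
by rewrite -ale_inA -eq_g -eq_y; apply: ale_mull.
Qed.

Lemma alub_seq x (L : seq artin) : exists z,
  (forall y, y \in x :: L -> ale y z) /\
  (forall t, (forall y, y \in x :: L -> ale y t) -> ale z t).
Proof.
elim: L => [|a L [z [up min]]].
  by exists x; split=> [y|t]; [rewrite inE => /eqP->; apply: ale_refl | apply; rewrite inE].
have [u [zu au min_u]] := alub_ex z a; exists u; split=> [y|t ub].
  rewrite !inE => /or3P[/eqP->|/eqP->//|yL]; apply: ale_trans zu; apply: up.
    exact: mem_head.
  by rewrite inE yL orbT.
apply: min_u; last by apply: ub; rewrite !inE eqxx orbT.
by apply: min => y; rewrite inE => /orP[|] yL; apply: ub; rewrite !inE yL ?orbT.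
Qed.

Import GRing.Theory Num.Theory.

Definition letter_sum (w : word) : int :=
  foldr (fun a n => (if a.2 then 1 else -1) + n)%R 0%R w.

Lemma letter_sum_cat u v : letter_sum (u ++ v) = (letter_sum u + letter_sum v)%R.
Proof. by elim: u => [|a u IH] /=; rewrite ?add0r // IH addrA. Qed.

Lemma letter_sum_pw p : letter_sum (pw p) = Posz (size p).
Proof. by elim: p => [|i p /= ->] //=; lia. Qed.

Definition degree x : int := letter_sum (word_of x).

Lemma degree_aw w : degree (aw w) = letter_sum w.
Proof.
apply: (aw_invariant (f := letter_sum)); last exact: aw_word.
  by move=> u i c v; rewrite !letter_sum_cat /=; case: c => /=; lia.
by move=> u i j v; rewrite !letter_sum_cat !letter_sum_pw !size_alt.
Qed.

Lemma degreeM x y : degree (x * y) = (degree x + degree y)%R.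
Proof. by rewrite -[x]aw_word -[y]aw_word -aw_cat !degree_aw letter_sum_cat. Qed.

Lemma degree1 : degree 1 = 0%R. Proof. by rewrite -aw_nil degree_aw. Qed.

Lemma degreeV x : degree x^-1 = (- degree x)%R.
Proof. by have := degreeM x^-1 x; rewrite mulVg degree1; lia. Qed.

Lemma degree_delta : degree delta = len w0.
Proof. by rewrite /delta /bdelta /atom_of inA_bw degree_aw letter_sum_pw size_red. Qed.

Definition dz (k : int) : artin :=
  if k is Posz n then delta ^+ n else delta ^- `|k|%N.

Lemma dzB (a b : nat) : dz (a%:Z - b%:Z)%R = delta ^+ a * delta ^- b.
Proof.
have [ba|ab] := leqP b a.
  by rewrite -(subnK ba) expgnDr mulgK PoszD addrK.
have [k ->] : exists k, b = (k.+1 + a)%N by exists (b - a).-1; lia.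
have -> : (a%:Z - (k.+1 + a)%:Z = Negz k)%R by rewrite NegzE; lia.
by rewrite expgnDr invgM mulVKg.
Qed.

Lemma int_diff (k : int) : exists a l : nat, k = (a%:Z - l%:Z)%R.
Proof. by case: k => n; [exists n, 0 | exists 0, n.+1]; lia. Qed.

Lemma dzD j k : dz (j + k)%R = dz j * dz k.
Proof.
have [a [b ->]] := int_diff j; have [c [d ->]] := int_diff k.
have -> : (a%:Z - b%:Z + (c%:Z - d%:Z) = (a + c)%:Z - (d + b)%:Z)%R by lia.
rewrite !dzB expgnDr expgnDr invgM -!mulgA; congr (_ * _); rewrite !mulgA.
congr (_ * _); apply: (commuteV (commuteX2 _ _ _)); exact: commute_refl.
Qed.

Lemma dz1 : dz 1 = delta. Proof. by []. Qed.

Lemma dzN k : dz (- k)%R = (dz k)^-1.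
Proof. by apply: (mulIg (dz k)); rewrite mulVg -dzD addNr. Qed.

Lemma dzX (c : bool) n :
  dz (if c then n%:Z else - n%:Z)%R = (if c then delta else delta^-1) ^+ n.
Proof. by case: c; rewrite ?dzN ?expVgn. Qed.

Lemma degree_dz k : degree (dz k) = (k * (len w0)%:Z)%R.
Proof.
have degX n : degree (delta ^+ n) = (n%:Z * (len w0)%:Z)%R.
  elim: n => [|n IH]; first by rewrite degree1 mul0r.
  by rewrite expgS degreeM IH degree_delta -[in RHS]add1n PoszD mulrDl mul1r.
have [a [b ->]] := int_diff k.
by rewrite dzB degreeM degreeV !degX mulrBl.
Qed.

(** Conjugation by [delta], in either direction, preserves positive elements; hence the right
    invariance of the order in [ale_dz]. *)
Lemma dz_conj k b : exists c, inA b * dz k = dz k * inA c.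
Proof.
have [n [l ->]] := int_diff k; rewrite dzB.
have pos a c : exists d, inA c * delta ^+ a = delta ^+ a * inA d.
  elim: a c => [|a IH] c; first by exists c; rewrite mul1g mulg1.
  have [d [_ eq_d]] := delta_conj c; have [g eq_g] := IH d; exists g.
  by rewrite expgS mulgA eq_d -mulgA eq_g mulgA.
have neg a c : exists d, inA c * delta ^- a = delta ^- a * inA d.
  elim: a c => [|a IH] c; first by exists c; rewrite invg1 mul1g mulg1.
  have [d eq_d] := IH c; have [g [eq_g _]] := delta_conj d; exists g.
  rewrite expgS invgM mulgA eq_d -!mulgA; congr (_ * _); apply: (mulgI delta).
  by rewrite mulVKg mulgA eq_g mulgK.
have [c eq_c] := pos n b; have [d eq_d] := neg l c; exists d.
by rewrite mulgA eq_c -mulgA eq_d mulgA.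
Qed.

Lemma ale_dz k x y : ale x y -> ale (x * dz k) (y * dz k).
Proof.
by case=> b ->; have [c eq_c] := dz_conj k b; exists c; rewrite -!mulgA eq_c.
Qed.

Lemma dz2C k x : dz (k *+ 2)%R * x = x * dz (k *+ 2)%R.
Proof.
have [a [b ->]] := int_diff k.
have -> : ((a%:Z - b%:Z) *+ 2 = (2 * a)%:Z - (2 * b)%:Z)%R by lia.
rewrite dzB !expgnA expg2 -/(_ ^- b); apply: commute_sym.
by apply: commuteM; [|apply: commuteV]; apply: commute_sym; apply: delta2XC.
Qed.

End ArtinGroup.

(** * Finite subgroups *)
Section FiniteSubgroups.
Local Open Scope group_scope.
Import Order.TTheory GRing.Theory Num.Theory.
Variables (I : finType) (m : I -> I -> nat).
Notation word := (seq (I * bool)).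
Local Notation W := (coxeter m).
Local Notation e := (ew m).
Local Notation len := (@len I m).
Local Notation B := (braid m).
Local Notation bw := (bw m).
Local Notation A := (artin m).
Local Notation aw := (aw m).

Hypothesis m_diag : forall i, m i i = 1%N.
Hypothesis m_sym : forall i j, m i j = m j i.
Hypothesis m_ge2 : forall i j, i != j -> 2 <= m i j.
Variable w0 : W.
Hypothesis w0_max : forall w, len w <= len w0.
Local Notation bdelta := (bdelta w0).
Local Notation delta := (delta w0).
Local Notation dz := (dz w0).

(** Braid relations preserve the size of a word and its value in [W], so every positive word for
    [bdelta] is reduced, and so are its prefixes. *)
Lemma dvd_bdelta (b b' : B) : bdelta = b * b' ->
  exists2 p, b = bw p & size p = len (e p) /\ size p <= len w0.
Proof.
have [p <-] := bw_surj b; have [q <-] := bw_surj b'; rewrite -bw_cat => eq_pq.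
exists p => //.
have eq_size : size (red w0) = size (p ++ q).
  by apply: bw_invariant eq_pq => *; rewrite !size_cat !size_alt.
have eq_e : e (red w0) = e (p ++ q).
  apply: bw_invariant eq_pq => *; rewrite !ew_cat; congr (_ * (_ * _)).
  exact: ew_braid.
rewrite size_red size_cat in eq_size; rewrite ew_red ew_cat in eq_e.
have := len_mul (e p) (e q); rewrite -eq_e.
by have := len_ew m p; have := len_ew m q; lia.
Qed.

Section Orbit.
Variables (K : A -> Prop) (L : seq A).
Hypothesis K1 : K 1.
Hypothesis KM : forall x y, K x -> K y -> K (x * y).
Hypothesis KV : forall x, K x -> K x^-1.
Hypothesis LK : forall l, l \in L -> K l.
Hypothesis L_cover : forall h, K h -> exists2 l, l \in L & exists k, h = l * dz (k *+ 2)%R.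

(* The join of all [h * delta ^ j] of degree at most [0], with [h] in [K], is
   moved downwards by every [h * _ * delta ^ j] of degree at most [0]. Two
   points of its orbit are therefore comparable, according to their degrees. *)
Lemma orbit_chain : exists x, forall h, K h ->
  exists b b' j, bdelta = b * b' /\ h * x = x * inA b * dz j.
Proof.
(* If [w0] is trivial there are no generators and every word is empty. *)
have [w0_eq0|w0_gt0] := posnP (len w0).
  exists 1 => h _; exists 1, 1, 0%R; rewrite !mulg1 inA1 !mulg1; split.
    apply/esym; rewrite -atom_of1 //; congr atom_of.
    by apply/esym/eqP; rewrite -len_eq0 w0_eq0.
  rewrite -[h]aw_word; case: (word_of h) => [|[i c] w]; first exact: aw_nil.
  by have := w0_max (gw m i); rewrite len_gw w0_eq0.
pose floor (n : int) : int := (n %/ (len w0)%:Z)%Z.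
have floorP (n j : int) : (j * (len w0)%:Z <= n)%R = (j <= floor n)%R.
  by rewrite /floor lez_divRL.
(* The largest power of [delta] keeping the degree nonpositive: these finitely many elements
   dominate the whole family. *)
pose top l := l * dz (floor (- degree l)%R).
have [l0 l0L _] := L_cover K1.
have [x [up min]] := alub_seq m_diag m_sym m_ge2 w0_max (top l0) (map top L).
have upper h j : K h -> (degree h + j * (len w0)%:Z <= 0)%R -> ale (h * dz j) x.
  move=> Kh; have [l lL [k ->]] := L_cover Kh; rewrite degreeM degree_dz => le0.
  apply: ale_trans (up (top l) _); last by rewrite inE map_f ?orbT.
  rewrite -mulgA -dzD //; apply: ale_mull.
  have le_floor : (k *+ 2 + j <= floor (- degree l)%R)%R.
    rewrite -floorP; move: le0; rewrite mulrDl; lia.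
  have [n ->] : exists n : nat, floor (- degree l)%R = (k *+ 2 + j + Posz n)%R.
    by exists (absz (floor (- degree l) - (k *+ 2 + j))%R); lia.
  by exists (bdelta ^+ n); rewrite [LHS]dzD // inAX.
have least t : (forall h j, K h -> (degree h + j * (len w0)%:Z <= 0)%R ->
    ale (h * dz j) t) -> ale x t.
  have topP l : l \in L -> K l /\ (degree l + floor (- degree l)%R * (len w0)%:Z <= 0)%R.
    move=> lL; split; first exact: LK.
    by have := floorP (- degree l)%R (floor (- degree l)%R); rewrite lexx; lia.
  move=> ub; apply: min => y; rewrite inE => /orP[/eqP->|/mapP[l lL ->]].
    by have [? ?] := topP _ l0L; apply: ub.
  by have [? ?] := topP _ lL; apply: ub.
(* The family is carried into itself by [h] and a shift of [j] in the exponent, so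
   [h^-1 * x * dz (- j)] also bounds it from above. *)
have down h j : K h -> (degree h + j * (len w0)%:Z <= 0)%R -> ale (h * x * dz j) x.
  move=> Kh le0; suff: ale x (h^-1 * x * dz (- j)%R).
    move=> /(ale_dz m_diag m_sym m_ge2 w0_max j) /(ale_mull h).
    by rewrite dzN // -!mulgA mulVg mulg1 mulVKg.
  apply: least => h' j' Kh' le0'.
  have := upper (h * h') (j' + j)%R (KM Kh Kh'); rewrite degreeM mulrDl.
  move=> /(_ ltac:(lia)) /(ale_mull h^-1) /(ale_dz m_diag m_sym m_ge2 w0_max (- j)%R).
  by rewrite dzD // dzN // -!mulgA mulgV mulg1 mulKg.
(* Applied to [h^-1] and to [h], [down] places [h * x] between [x * dz j] and [x * dz (j + 1)]. *)
exists x => h Kh; pose j := floor (degree h).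
have j_le : (j * (len w0)%:Z <= degree h)%R by rewrite floorP.
have j_gt : (degree h < (j + 1) * (len w0)%:Z)%R by rewrite ltNge floorP -ltNge; lia.
have [|b eq_b] := down h^-1 j (KV Kh); first by rewrite degreeV; lia.
have [|b' eq_b'] := down h (- (j + 1))%R Kh; first by rewrite mulNr; lia.
have : ale x (h * x * dz (- j)%R).
  have := ale_dz m_diag m_sym m_ge2 w0_max (- j)%R (ale_mull h (ex_intro _ b eq_b)).
  by rewrite dzN // -!mulgA mulgV mulg1 mulVKg.
have : ale (h * x * dz (- j)%R) (x * delta).
  have := ale_dz m_diag m_sym m_ge2 w0_max 1%R (ex_intro _ b' eq_b').
  by rewrite -mulgA -dzD // opprD addrNK dz1.
case=> c' eq_c' [c eq_c]; exists c, c', j; split.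
  apply: (inA_inj m_diag m_sym m_ge2 w0_max); apply: (mulgI x).
  by rewrite inA_mul mulgA -eq_c.
by rewrite -eq_c dzN // mulgVK.
Qed.

End Orbit.
End FiniteSubgroups.

(** Classical truth values, used to filter finite lists by undecided predicates. *)
Definition decide (P : Prop) : bool :=
  if excluded_middle_informative P then true else false.

Lemma decideP P : reflect P (decide P).
Proof. by rewrite /decide; case: excluded_middle_informative; constructor. Qed.

(** * Simplices and subgroups given by words *)

Section Words.
Local Open Scope group_scope.
Import Order.TTheory GRing.Theory Num.Theory.
Variables (I : finType) (m : I -> I -> nat).
Notation word := (seq (I * bool)).
Local Notation e := (ew m).
Local Notation len := (@len I m).
Local Notation A := (artin m).
Local Notation aw := (aw m).

Hypothesis m_diag : forall i, m i i = 1%N.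
Hypothesis m_sym : forall i j, m i j = m j i.
Hypothesis m_ge2 : forall i j, i != j -> 2 <= m i j.
Variables (d : word) (w0 : coxeter m).
Hypothesis w0_max : forall w, len w <= len w0.
Hypothesis d_delta : aw d = delta w0.
Local Notation bdelta := (bdelta w0).
Local Notation dz := (dz w0).
Local Notation geq := Defs.geq.

Lemma aw_dpow c n : aw (dpow d c n) = dz (if c then Posz n else - Posz n)%R.
Proof.
rewrite dzX // -d_delta /dpow; elim: n => [|n IH] //=.
by rewrite aw_cat IH expgS; case: c {IH}; rewrite ?aw_winv.
Qed.

Lemma veqP u v : veq m d u v <-> exists k, aw u = aw v * dz k.
Proof.
split=> [[c [n /awP]]|[k eq_uv]].
  by rewrite aw_cat aw_dpow => eq_uv; eexists; exact: eq_uv.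
exists (0 <= k)%R, `|k|%N; apply/awP; rewrite aw_cat aw_dpow eq_uv.
by congr (_ * dz _); case: ifP; lia.
Qed.

Lemma geqP u v : geq m d u v <-> exists k, aw u = aw v * dz (k *+ 2)%R.
Proof.
split=> [[c [n /awP]]|[k eq_uv]].
  rewrite aw_cat aw_dpow => ->; exists (if c then Posz n else - Posz n)%R.
  by congr (_ * dz _); case: c; lia.
exists (0 <= k)%R, `|k|%N; apply/awP; rewrite aw_cat aw_dpow eq_uv.
by congr (_ * dz _); case: ifP; lia.
Qed.

Lemma geq_aw u v : aw u = aw v -> geq m d u v.
Proof. by move=> uv; apply/geqP; exists 0%R; rewrite mulg1. Qed.

Lemma geq_sym u v : geq m d u v -> geq m d v u.
Proof.
move=> /geqP[k eq_uv]; apply/geqP; exists (- k)%R.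
by rewrite mulNrn dzN // eq_uv mulgK.
Qed.

Lemma simple_is_atom p : size p = len (e p) -> is_atom m (pw p).
Proof. by move=> red_p; exists p; split; [apply/awP | apply/coxlenP]. Qed.

(** The atom [pw p] is the special representative: were it trivial or equal to [d], it would be a
    power of [delta], and [u] and [v] the same vertex. *)
Lemma simple_dat u v p k : size p = len (e p) ->
  aw v = aw u * aw (pw p) * dz k -> ~ veq m d u v -> dat m d u v 1.
Proof.
move=> red_p eq_v nveq.
have triv j : aw (pw p) = dz j -> False.
  move=> eq_p; apply: nveq; apply/veqP; exists (- (j + k))%R.
  rewrite eq_v eq_p -!mulgA -!dzD // (_ : (j + (k + - (j + k)) = 0)%R) ?mulg1 //.
  lia.
exists (pw p), [:: pw p]; split; last split; last split=> //.
- by apply/veqP; exists k; rewrite aw_cat aw_winv eq_v -mulgA mulKg.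
- split; first by rewrite /= cats0; apply/awP.
  split=> [a|[]//= _]; first by rewrite inE => /eqP-> /awP /(triv 0%R).
  rewrite cats0; split; first exact: simple_is_atom.
  by split=> //; exists [::]; split; [exists [::] | rewrite cats0]; apply/awP.
- by move=> a; rewrite inE => /eqP-> /awP; rewrite d_delta => /(triv 1%R).
Qed.

Section Subgroup.
Variable H : word -> Prop.
Hypotheses (H_group : is_subgroupG m d H) (H_fin : finiteG m d H).

Lemma subgroup_aw u v : aw u = aw v -> H v -> H u.
Proof. by case: H_group => _ [_ [_ Hgeq]] /geq_aw; apply: Hgeq. Qed.

(** [finiteG] allows representatives outside [H]; these are dropped, and those equivalent to an
    element of [H] remain. *)
Lemma finite_cover : exists L : seq word,
  (forall l, l \in L -> H l) /\
  (forall h, H h -> exists2 l, l \in L & geq m d h l).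
Proof.
have [L0 cover] := H_fin.
exists (filter (fun w => decide (H w)) L0); split=> [l|h Hh].
  by rewrite mem_filter => /andP[/decideP].
have [l lL0 hl] := cover h Hh; exists l => //; rewrite mem_filter lL0 andbT.
by apply/decideP; case: H_group => _ [_ [_ Hgeq]]; apply: Hgeq Hh; apply: geq_sym.
Qed.

Lemma orbit_simplex : exists x : A, forall h, H h -> exists p k,
  [/\ size p = len (e p), size p <= len w0 & aw h * x = x * aw (pw p) * dz k].
Proof.
have [H1 [HM [HV Hgeq]]] := H_group; have [L [LH cover]] := finite_cover.
pose K (x : A) := H (word_of x).
have KaP w : K (aw w) <-> H w by split; apply: subgroup_aw; rewrite aw_word.
have [||||| x orbit] :=
    @orbit_chain _ _ m_diag m_sym m_ge2 _ w0_max K (map aw L).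
- exact/(KaP [::]).
- by move=> x y Kx Ky; apply: subgroup_aw (HM _ _ Kx Ky); rewrite aw_cat !aw_word.
- by move=> x Kx; apply: subgroup_aw (HV _ Kx); rewrite aw_winv !aw_word.
- by move=> _ /mapP[l lL ->]; apply/KaP/LH.
- move=> h /cover[l lL /geqP[k eq_h]]; exists (aw l); first exact: map_f.
  by exists k; rewrite -eq_h aw_word.
exists x => h /KaP/orbit[b [b' [k [def_d eq_h]]]].
have [p def_b [red_p le_p]] := dvd_bdelta def_d.
by exists p, k; split=> //; rewrite eq_h def_b inA_bw.
Qed.

(** The vertices are the [aw l * x]. For two of them, [winv l ++ l'] lies in [H], so [orbit_simplex]
    relates them by an atom. *)
Lemma invariant_simplex :
  exists s : seq word, is_simplex m d s /\ leaves_invariant m d H s.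
Proof.
have [H1 [HM [HV Hgeq]]] := H_group; have [L [LH cover]] := finite_cover.
have [x orbit] := orbit_simplex.
have actP h l : H h -> l \in L -> exists2 l', l' \in L &
    veq m d (h ++ word_of (aw l * x)) (word_of (aw l' * x)).
  move=> Hh /LH Hl; have [l' l'L /geqP[k eq_hl]] := cover _ (HM _ _ Hh Hl).
  exists l' => //; apply/veqP; exists (k *+ 2)%R.
  rewrite aw_cat !aw_word mulgA -aw_cat eq_hl -!mulgA.
  by rewrite (dz2C m_diag m_sym m_ge2 w0_max).
exists [seq word_of (aw l * x) | l <- L]; split; first split.
- by have [l lL _] := cover _ H1; case: L lL {LH cover actP}.
- move=> _ _ /mapP[l lL ->] /mapP[l' l'L ->].
  have [p [k [red_p _ eq_p]]] := orbit _ (HM _ _ (HV _ (LH _ lL)) (LH _ l'L)).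
  apply: (simple_dat red_p (k := k)).
  by rewrite !aw_word -!mulgA [x * _]mulgA -eq_p aw_cat aw_winv -!mulgA mulVKg.
move=> h Hh; split=> [_ /mapP[l lL ->]|_ /mapP[l lL ->]].
  have [l' l'L eq_l] := actP h l Hh lL; exists (word_of (aw l' * x)) => //.
  by apply/mapP; exists l'.
have [l' l'L /veqP[k eq_l]] := actP _ l (HV _ Hh) lL.
exists (word_of (aw l' * x)); first by apply/mapP; exists l'.
apply/veqP; exists (- k)%R; rewrite dzN // aw_cat.
by apply: (mulIg (dz k)); rewrite mulgVK -mulgA -eq_l aw_cat aw_winv mulVKg.
Qed.

End Subgroup.

Fixpoint short_words n : seq (seq I) :=
  if n is n'.+1 then [::] :: [seq i :: p | i <- enum I, p <- short_words n']
  else [:: [::]].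

Lemma mem_short_words n p : size p <= n -> p \in short_words n.
Proof.
elim: n p => [|n IH] [|i p] //= le_p; rewrite inE /=.
by apply/allpairsP; exists (i, p); rewrite mem_enum IH.
Qed.

(** A finite list covering all atoms is enough, so the words are only bounded in size; the suffix
    [d] accounts for odd powers of [delta]. *)
Definition simple_classes : seq word :=
  [seq pw p | p <- short_words (len w0)] ++
  [seq pw p ++ d | p <- short_words (len w0)].

Lemma simple_class w p k : size p <= len w0 -> aw w = aw (pw p) * dz k ->
  exists2 c, c \in simple_classes & geq m d w c.
Proof.
move=> le_p eq_w; have [j [eq_k|eq_k]] : exists j, k = (j *+ 2)%R \/ k = (1 + j *+ 2)%R.
- by exists (k %/ 2)%Z; lia.
- exists (pw p); first by rewrite mem_cat map_f ?mem_short_words.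
  by apply/geqP; exists j; rewrite eq_w eq_k.
exists (pw p ++ d).
  by rewrite mem_cat orbC (map_f (fun p => pw p ++ d)) ?mem_short_words.
by apply/geqP; exists j; rewrite eq_w eq_k aw_cat d_delta dzD // mulgA.
Qed.

Fixpoint subseqs (T : Type) (C : seq T) : seq (seq T) :=
  if C is c :: C' then subseqs C' ++ map (cons c) (subseqs C') else [:: [::]].

Lemma filter_subseqs (T : eqType) (a : pred T) C : filter a C \in subseqs C.
Proof.
elim: C => [|c C IH] //=; rewrite mem_cat; case: ifP => _; last by rewrite IH.
by rewrite map_f ?orbT.
Qed.

Definition class_union (D : seq word) : word -> Prop :=
  fun w => exists2 c, c \in D & geq m d w c.

Lemma conjugate_class_union H : is_subgroupG m d H -> finiteG m d H ->
  exists D, [/\ D \in subseqs simple_classes, is_subgroupG m d (class_union D),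
    finiteG m d (class_union D) & conjG H (class_union D)].
Proof.
move=> H_group H_fin; have [x orbit] := orbit_simplex H_group H_fin.
have [H1 [HM [HV Hgeq]]] := H_group.
pose K w := H (word_of (x * aw w * x^-1)).
have K_geq u v : geq m d u v -> K v -> K u.
  move=> /geqP[k eq_uv]; apply: Hgeq; apply/geqP; exists k.
  by rewrite !aw_word eq_uv -!mulgA (dz2C m_diag m_sym m_ge2 w0_max).
have K_cover w : K w -> exists2 c, c \in simple_classes & geq m d w c.
  (* The orbit equation of [x * aw w * x^-1] is [x * aw w = x * aw (pw p) * dz k], and [x]
     cancels. *)
  move=> /orbit[p [k [_ le_p]]]; rewrite aw_word mulgVK -mulgA => /mulgI.
  exact: simple_class.
pose D := filter (fun c => decide (K c)) simple_classes.
have KE w : K w <-> class_union D w.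
  split=> [Kw|[c]]; last by rewrite mem_filter => /andP[/decideP Kc _] /K_geq; apply.
  have [c c_in wc] := K_cover w Kw; exists c => //; rewrite mem_filter c_in andbT.
  by apply/decideP; apply: K_geq Kw; apply: geq_sym.
exists D; split; first exact: filter_subseqs.
- split; [|split; [|split]].
  + by apply/KE; rewrite /K mulg1 mulgV; apply: (subgroup_aw H_group) H1; rewrite aw_word.
  + move=> u v /KE Ku /KE Kv; apply/KE.
    apply: (subgroup_aw H_group) (HM _ _ Ku Kv).
    by rewrite !(aw_cat, aw_word) -!mulgA mulKg.
  + move=> u /KE Ku; apply/KE; apply: (subgroup_aw H_group) (HV _ Ku).
    by rewrite !(aw_winv, aw_word) !invgM invgK mulgA.
  + by move=> u v uv /KE Kv; apply/KE/(K_geq _ _ uv).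
- by exists simple_classes => w /KE/K_cover.
exists (word_of x) => z; rewrite -KE /K !aw_cat aw_winv aw_word.
rewrite -!mulgA mulgV mulg1 mulVKg.
by split; apply: (subgroup_aw H_group); rewrite aw_word.
Qed.

(** The family is indexed by the sublists of [simple_classes] whose classes form a finite subgroup;
    it may list a conjugacy class several times. *)
Lemma finitely_many_conjugacy_classes : exists (n : nat) (F : nat -> word -> Prop),
  (forall i, i < n -> is_subgroupG m d (F i) /\ finiteG m d (F i)) /\
  (forall H, is_subgroupG m d H -> finiteG m d H -> exists2 i, i < n & conjG H (F i)).
Proof.
pose valid D := decide (is_subgroupG m d (class_union D) /\ finiteG m d (class_union D)).
pose Ds := filter valid (subseqs simple_classes).
exists (size Ds), (fun i => class_union (nth [::] Ds i)); split=> [i lt_i|H H_group H_fin].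
  by have := mem_nth [::] lt_i; rewrite mem_filter => /andP[/decideP].
have [D [D_in D_group D_fin HD]] := conjugate_class_union H_group H_fin.
have DDs : D \in Ds by rewrite mem_filter D_in andbT; apply/decideP.
by exists (index D Ds); rewrite ?index_mem ?nth_index.
Qed.

End Words.

Theorem theorem3p12 (I : finType) (m : I -> I -> nat)
  (hdiag : forall i, m i i = 1)
  (hsym : forall i j, m i j = m j i)
  (hge2 : forall i j, i != j -> 2 <= m i j)
  (hfin : coxeter_finite m)
  (d : @word I) (hd : is_Delta m d) :
  (forall H : @word I -> Prop, is_subgroupG m d H -> finiteG m d H ->
     exists s : seq (@word I), is_simplex m d s /\ leaves_invariant m d H s) /\
  (exists (n : nat) (F : nat -> @word I -> Prop),
     (forall i, i < n -> is_subgroupG m d (F i) /\ finiteG m d (F i)) /\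
     (forall H : @word I -> Prop, is_subgroupG m d H -> finiteG m d H ->
        exists2 i, i < n & conjG H (F i))).
Proof.
have [p [/awP d_p [/coxlenP red_p max_p]]] := hd.
pose w0 := ew m p.
have w0_max (w : coxeter m) : len w <= len w0.
  by rewrite /w0 -red_p -[w]ew_red; apply: max_p; apply/coxlenP.
have d_delta : aw m d = delta w0 by rewrite d_p -inA_bw /delta /bdelta atom_of_ew.
split=> [H H_group H_fin|].
  exact: (invariant_simplex hdiag hsym hge2 w0_max d_delta H_group H_fin).
exact: (finitely_many_conjugacy_classes hdiag hsym hge2 w0_max d_delta).
Qed.
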